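(* Let $r\geq1$ and let $Q_r$ be the quiver $0\leftarrow1\leftarrow2\leftarrow\cdots\leftarrow r-1$ of Dynkin type $\mathbb{A}_r$. Then for any $i\in\{0,\ldots,r-1\}$ and any $n\in\{1,\ldots,r-i\}$, $$X_{S_i^{(n)}}=P_n(X_{S_i},\ldots,X_{S_{i+n-1}}).$$
   Context: $k$ is an algebraically closed field; $kQ_r$-mod is the category of finitely generated left $kQ_r$-modules, identified with finite-dimensional representations of $Q_r$ over $k$. $S_i$ is the simple module at vertex $i$, and $S_i^{(n)}$ ($1\le n\le r-i$) is the unique indecomposable module with socle $S_i$ and length $n$. $\mathbf{dim}\,M=(\dim M_i)_{0\le i\le r-1}\in\mathbb{Z}^r$ and $\alpha_i=\mathbf{dim}\,S_i$. The Euler form is $\langle M,N\rangle=\dim\mathrm{Hom}(M,N)-\dim\mathrm{Ext}^1(M,N)$; it depends only on dimension vectors and so is defined on $\mathbb{Z}^r$. Caldero-Chapoton map (cluster character): let $\mathbf{u}=(u_0,\ldots,u_{r-1})$ be indeterminates. For a module $M$ and $\mathbf{e}\in\mathbb{N}^r$, $\mathrm{Gr}_{\mathbf{e}}(M)$ is the projective variety of submodules of $M$ of dimension vector $\mathbf{e}$, and $\chi$ is the Euler characteristic (of the underlying topological space if $k=\mathbb{C}$, or of $\ell$-adic cohomology in general). Then $$X_M=\sum_{\mathbf{e}}\chi(\mathrm{Gr}_{\mathbf{e}}(M))\prod_{i=0}^{r-1}u_i^{-\langle\mathbf{e},\alpha_i\rangle-\langle\alpha_i,\mathbf{dim}\,M-\mathbf{e}\rangle}\in\mathbb{Z}[\mathbf{u}^{\pm1}].$$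 Generalized Chebyshev polynomials: $P_0=1$, $P_1(x_1)=x_1$, and $P_{n+1}(x_1,\ldots,x_{n+1})=x_{n+1}P_n(x_1,\ldots,x_n)-P_{n-1}(x_1,\ldots,x_{n-1})$ for $n\geq1$. *)

(* Defs.v *)
From HB Require Import structures.
From mathcomp Require Import all_boot all_order all_algebra.
From mathcomp Require Import complex.
From mathcomp Require Import -(notations) mpoly.
From mathcomp Require Import all_classical all_reals all_analysis.

Set Implicit Arguments.
Unset Strict Implicit.
Unset Printing Implicit Defensive.

Import Order.TTheory GRing.Theory Num.Theory.
Import numFieldNormedType.Exports.

Local Open Scope classical_set_scope.
Local Open Scope ring_scope.

(******************************************************************************)
(*  Modules over the path algebra of Q_r : 0 <- 1 <- ... <- r-1               *)
(******************************************************************************)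

(* An arrow s -> t of Q_r is a pair (s, t) with s = t + 1. *)
Definition arrow (r : nat) : Type :=
  {a : 'I_r * 'I_r | a.1 == a.2.+1 :> nat}.
Definition src (r : nat) (a : arrow r) : 'I_r := (val a).1.
Definition tgt (r : nat) (a : arrow r) : 'I_r := (val a).2.

(* A finite-dimensional left kQ_r-module: a finite-dimensional space with the
   actions of the generators of kQ_r, namely the trivial paths e_i (a complete
   system of orthogonal idempotents) and the arrows a = e_(tgt a) a e_(src a).
   The corresponding representation has M_i = e_i M. *)
Record kQmod (k : fieldType) (r : nat) := KQmod {
  carrier :> vectType k;
  idem : 'I_r -> 'End(carrier);
  act : arrow r -> 'End(carrier);
  idemM : forall i j : 'I_r,
    (idem i \o idem j)%VF = if i == j then idem i else 0;
  idem_sum : \sum_(i < r) idem i = \1%VF;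
  act_src : forall a : arrow r, (act a \o idem (src a))%VF = act a;
  act_tgt : forall a : arrow r, (idem (tgt a) \o act a)%VF = act a
}.

Definition is_hom (k : fieldType) (r : nat) (M N : kQmod k r)
    (f : 'Hom(M, N)) : Prop :=
  (forall i : 'I_r, (f \o idem M i)%VF = (idem N i \o f)%VF) /\
  (forall a : arrow r, (f \o act M a)%VF = (act N a \o f)%VF).

Definition hom_space (k : fieldType) (r : nat) (M N : kQmod k r) :
    {vspace 'Hom(M, N)} :=
  ((\bigcap_(i < r)
      lker (linfun (fun f : 'Hom(M, N) =>
                      (f \o idem M i)%VF - (idem N i \o f)%VF))) :&:
   (\bigcap_(a : arrow r)
      lker (linfun (fun f : 'Hom(M, N) =>
                      (f \o act M a)%VF - (act N a \o f)%VF))))%VS.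

Definition submodule (k : fieldType) (r : nat) (M : kQmod k r)
    (U : {vspace M}) : Prop :=
  (forall i : 'I_r, (idem M i @: U <= U)%VS) /\
  (forall a : arrow r, (act M a @: U <= U)%VS).

Definition sub_dimv (k : fieldType) (r : nat) (M : kQmod k r)
    (U : {vspace M}) : {ffun 'I_r -> nat} :=
  [ffun i => \dim (idem M i @: U)%VS].

Definition dimv (k : fieldType) (r : nat) (M : kQmod k r) :
    {ffun 'I_r -> nat} := sub_dimv (fullv : {vspace M}).

Definition simple_idem (k : fieldType) (r : nat) (i j : 'I_r) : 'End(k^o) :=
  if i == j then \1%VF else 0.

Lemma simple_idemM (k : fieldType) (r : nat) (v i j : 'I_r) :
  (simple_idem k v i \o simple_idem k v j)%VF =
  if i == j then simple_idem k v i else 0.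
Proof.
rewrite /simple_idem; case: (eqVneq i j) => [<-|nij].
  by case: ifP => _; rewrite ?comp_lfun1l ?comp_lfun0l.
case: (eqVneq v i) => [->|_]; last by rewrite comp_lfun0l.
by rewrite (negbTE nij) comp_lfun0r.
Qed.

Lemma simple_idem_sum (k : fieldType) (r : nat) (v : 'I_r) :
  \sum_(i < r) simple_idem k v i = \1%VF.
Proof.
rewrite (bigD1 v) //= /simple_idem eqxx big1 ?addr0 // => i niv.
by rewrite eq_sym (negbTE niv).
Qed.

(* The simple module at vertex i: the space k concentrated at i. *)
Definition simple_mod (k : fieldType) (r : nat) (i : 'I_r) : kQmod k r :=
  @KQmod k r k^o (simple_idem k i) (fun=> 0)
    (simple_idemM k i) (simple_idem_sum k i)
    (fun a => comp_lfun0l _ _) (fun a => comp_lfun0r _ _).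

Definition simple_sub (k : fieldType) (r : nat) (M : kQmod k r)
    (U : {vspace M}) : Prop :=
  [/\ submodule U, U <> 0%VS &
      forall W : {vspace M}, submodule W -> (W <= U)%VS -> W = 0%VS \/ W = U].

Definition is_socle (k : fieldType) (r : nat) (M : kQmod k r)
    (U : {vspace M}) : Prop :=
  [/\ submodule U,
      (forall W : {vspace M}, simple_sub W -> (W <= U)%VS) &
      (forall V : {vspace M}, submodule V ->
         (forall W : {vspace M}, simple_sub W -> (W <= V)%VS) -> (U <= V)%VS)].

Definition has_socle (k : fieldType) (r : nat) (M S : kQmod k r) : Prop :=
  exists f : 'Hom(S, M), [/\ is_hom f, lker f = 0%VS & is_socle (limg f)].

(* c is a composition series 0 = c 0 < c 1 < ... < c n = M. *)
Definition has_length (k : fieldType) (r : nat) (M : kQmod k r) (n : nat) :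
    Prop :=
  exists c : nat -> {vspace M},
    [/\ c 0%N = 0%VS, c n = fullv,
        (forall m : nat, (m <= n)%N -> submodule (c m)) &
        (forall m : nat, (m < n)%N ->
           [/\ (c m <= c m.+1)%VS, c m <> c m.+1 &
               forall W : {vspace M}, submodule W ->
                 (c m <= W)%VS -> (W <= c m.+1)%VS ->
                 W = c m \/ W = c m.+1])].

Definition indecomposable (k : fieldType) (r : nat) (M : kQmod k r) : Prop :=
  (fullv : {vspace M}) <> 0%VS /\
  forall U W : {vspace M}, submodule U -> submodule W ->
    (U + W)%VS = fullv -> (U :&: W)%VS = 0%VS -> U = 0%VS \/ W = 0%VS.

(* M is (a model of) S_i^(n). *)
Definition is_serial (k : fieldType) (r : nat) (i : 'I_r) (n : nat)
    (M : kQmod k r) : Prop :=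
  [/\ indecomposable M, has_socle M (simple_mod k i) & has_length M n].

(******************************************************************************)
(*  Euler form                                                                *)
(******************************************************************************)

Definition projective_mod (k : fieldType) (r : nat) (P : kQmod k r) : Prop :=
  forall (A B : kQmod k r) (g : 'Hom(A, B)) (f : 'Hom(P, B)),
    is_hom g -> is_hom f -> limg g = fullv ->
    exists h : 'Hom(P, A), is_hom h /\ (g \o h)%VF = f.

(* d = dim Ext^1(M, N), where for 0 -> K -i-> P -p-> M -> 0 exact with P
   projective Ext^1(M, N) is the cokernel of i^* : Hom(P, N) -> Hom(K, N). *)
Definition is_dim_ext1 (k : fieldType) (r : nat) (M N : kQmod k r) (d : nat) :
    Prop :=
  exists (K P : kQmod k r) (i : 'Hom(K, P)) (p : 'Hom(P, M)),
    [/\ is_hom i, is_hom p & projective_mod P] /\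
    [/\ lker i = 0%VS, limg i = lker p, limg p = fullv &
        d = (\dim (hom_space K N) -
             \dim (linfun (fun f : 'Hom(P, N) => (f \o i)%VF)
                     @: hom_space P N)%VS)%N].

Definition intv (r : nat) (e : {ffun 'I_r -> nat}) : {ffun 'I_r -> int} :=
  [ffun i => (e i)%:Z].

(* E is the Euler form over k on Z^r: the biadditive form whose value on
   dimension vectors of modules is dim Hom - dim Ext^1. *)
Definition is_euler_form (k : fieldType) (r : nat)
    (E : {ffun 'I_r -> int} -> {ffun 'I_r -> int} -> int) : Prop :=
  [/\ (forall x y z, E (x + y) z = E x z + E y z),
      (forall x y z, E x (y + z) = E x y + E x z) &
      (forall (M N : kQmod k r) (d : nat), is_dim_ext1 M N d ->
         E (intv (dimv M)) (intv (dimv N)) =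
         (\dim (hom_space M N))%:Z - d%:Z)].

(******************************************************************************)
(*  Varieties                                                                 *)
(******************************************************************************)

(* A variety X presented as the image of a locally closed subset Y = dom X of
   an affine space under a map proj X : Y -> X admitting sections locally on X
   (for the Grassmannian: Y is the set of frames, proj sends a frame to its
   span).  X carries the quotient structure: a subset of X x A^q is open, and
   a function on it is regular, when its pullback to Y x A^q is. *)
Record variety (k : fieldType) := Variety {
  point : Type;
  adim : nat;
  dom : set 'rV[k]_adim;
  proj : 'rV[k]_adim -> point
}.
Arguments dom {k} X _ : rename.
Arguments proj {k} X _ : rename.

Definition peval (k : fieldType) (m q : nat) (p : mpoly.mpoly (m + q) k)
    (y : 'rV[k]_m) (t : 'rV[k]_q) : k :=
  mpoly.meval (fun j => row_mx y t 0 j) p.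

Definition zopen (k : fieldType) (X : variety k) (q : nat)
    (O : set (point X * 'rV[k]_q)) : Prop :=
  forall (y : 'rV[k]_(adim X)) (t : 'rV[k]_q), dom X y -> O (proj X y, t) ->
  exists p : mpoly.mpoly (adim X + q) k, peval p y t != 0 /\
    forall y' t', dom X y' -> peval p y' t' != 0 -> O (proj X y', t').

Definition regular (k : fieldType) (X : variety k) (q : nat)
    (D : set (point X * 'rV[k]_q)) (f : point X -> 'rV[k]_q -> k) : Prop :=
  forall (y : 'rV[k]_(adim X)) (t : 'rV[k]_q), dom X y -> D (proj X y, t) ->
  exists p s : mpoly.mpoly (adim X + q) k, peval s y t != 0 /\
    forall y' t', dom X y' -> D (proj X y', t') -> peval s y' t' != 0 ->
      f (proj X y') t' = peval p y' t' / peval s y' t'.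

(* Local constancy for the Zariski topology.  It may be tested on Y x A^q
   because Y x A^q -> X x A^q is open. *)
Definition loc_const (k : fieldType) (X : variety k) (q : nat)
    (D : set (point X * 'rV[k]_q)) (f : point X -> 'rV[k]_q -> int) : Prop :=
  forall (y : 'rV[k]_(adim X)) (t : 'rV[k]_q), dom X y -> D (proj X y, t) ->
  exists s : mpoly.mpoly (adim X + q) k, peval s y t != 0 /\
    forall y' t', dom X y' -> D (proj X y', t') -> peval s y' t' != 0 ->
      f (proj X y') t' = f (proj X y) t.

(******************************************************************************)
(*  l-adic Euler characteristic (k algebraically closed, l invertible in k).  *)
(*  For quasi-projective X, etale cohomology is computed by the direct limit  *)
(*  of Cech complexes over etale coverings (M. Artin, On the joins of Hensel  *)
(*  rings), and coverings by standard etale maps are cofinal.                 *)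
(******************************************************************************)

(* The etale X-scheme {(x, t) in O | G_x(t) = 0, G_x'(t) <> 0}, where O is open
   in X x A^1 and G is a polynomial in t with coefficients regular on the image
   of O in X. *)
Record chart (k : fieldType) (X : variety k) := Chart {
  copen : set (point X * 'rV[k]_1);
  cpoly : point X -> {poly k};
  copenP : zopen copen;
  cpoly_size : exists d : nat, forall x, (size (cpoly x) <= d)%N;
  cpoly_regular : forall j : nat,
    regular [set z : point X * 'rV[k]_0 | exists t, copen (z.1, t)]
            (fun x _ => (cpoly x)`_j)
}.

Definition in_chart (k : fieldType) (X : variety k) (c : chart X)
    (x : point X) (t : k) : Prop :=
  [/\ copen c (x, const_mx t), (cpoly c x).[t] = 0 & (cpoly c x)^`().[t] != 0].

Record covering (k : fieldType) (X : variety k) := Covering {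
  csize : nat;
  cchart :> 'I_csize -> chart X;
  coveringP : forall y : 'rV[k]_(adim X), dom X y ->
    exists (i : 'I_csize) (t : k), in_chart (cchart i) (proj X y) t
}.

(* The fibre product over X of the charts I 0, ..., I p of a covering. *)
Definition overlap (k : fieldType) (X : variety k) (U : covering X) (p : nat)
    (I : 'I_p.+1 -> 'I_(csize U)) : set (point X * 'rV[k]_p.+1) :=
  [set z : point X * 'rV[k]_p.+1 |
           (exists2 y, dom X y & proj X y = z.1) /\
           forall j : 'I_p.+1, in_chart (U (I j)) z.1 (z.2 0 j)].

(* Cech p-cochains with integral coefficients; only the values on overlaps
   matter. As locally constant functions lift from Z/N to Z, cochains with
   values in Z/N are integral cochains taken modulo N. *)
Definition cech (k : fieldType) (X : variety k) (U : covering X) (p : nat) :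
    Type :=
  ('I_p.+1 -> 'I_(csize U)) -> point X -> 'rV[k]_p.+1 -> int.

Definition cech0 (k : fieldType) (X : variety k) (U : covering X) (p : nat) :
    cech U p := fun _ _ _ => 0.
Arguments cech0 {k X} U p _ _ _.

Definition cech_ok (k : fieldType) (X : variety k) (U : covering X) (p : nat)
    (f : cech U p) : Prop :=
  forall I : 'I_p.+1 -> 'I_(csize U), loc_const (overlap I) (f I).

Definition cech_d (k : fieldType) (X : variety k) (U : covering X) (p : nat)
    (f : cech U p) : cech U p.+1 :=
  fun I x t =>
    \sum_(j < p.+2) (-1) ^+ j * f (fun l => I (lift j l)) x (col' j t).

Definition cech_eq (k : fieldType) (X : variety k) (U : covering X) (p : nat)
    (N : nat) (f g : cech U p) : Prop :=
  forall (I : 'I_p.+1 -> 'I_(csize U)) x t, overlap I (x, t) ->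
    (f I x t = g I x t %[mod N])%Z.

Definition cech_cocycle (k : fieldType) (X : variety k) (U : covering X)
    (p : nat) (N : nat) (f : cech U p) : Prop :=
  cech_ok f /\ cech_eq N (cech_d f) (cech0 U p.+1).

Definition cech_coboundary (k : fieldType) (X : variety k) (U : covering X)
    (p : nat) (N : nat) : cech U p -> Prop :=
  match p return cech U p -> Prop with
  | 0 => fun f => cech_eq N f (cech0 U 0)
  | p'.+1 => fun f => exists2 h : cech U p', cech_ok h & cech_eq N f (cech_d h)
  end.

Record refinement (k : fieldType) (X : variety k) (W U : covering X) :=
  Refinement {
  rindex : 'I_(csize W) -> 'I_(csize U);
  rmap : 'I_(csize W) -> point X -> 'rV[k]_1 -> k;
  rmap_regular : forall i : 'I_(csize W),
    regular (overlap (fun _ : 'I_1 => i)) (rmap i);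
  rmapP : forall (i : 'I_(csize W)) x t,
    overlap (fun _ : 'I_1 => i) (x, t) ->
    in_chart (U (rindex i)) x (rmap i x t)
}.

Definition pullback (k : fieldType) (X : variety k) (W U : covering X)
    (rho : refinement W U) (p : nat) (f : cech U p) : cech W p :=
  fun I x t => f (fun j => rindex rho (I j)) x
                 (\row_j rmap rho (I j) x (const_mx (t 0 j))).

(* f and g have the same class in H^p(X, Z/N). *)
Definition same_class (k : fieldType) (X : variety k) (U V : covering X)
    (p : nat) (N : nat) (f : cech U p) (g : cech V p) : Prop :=
  exists (W : covering X) (rho : refinement W U) (tau : refinement W V),
    cech_coboundary N
      (fun I x t => pullback rho f I x t - pullback tau g I x t).

(* There are d elements of lim_v H^p(X, Z/l^v) which are linearly independent
   over Z_l = lim_v Z/l^v, i.e. dim_(Q_l) H^p(X, Q_l) >= d. At each level v, the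
   d classes are represented on a common covering. *)
Definition ladic_indep (k : fieldType) (X : variety k) (l p d : nat) : Prop :=
  exists (U : nat -> covering X) (f : forall v : nat, 'I_d -> cech (U v) p),
    [/\ (forall v i, cech_cocycle (l ^ v) (f v i)),
        (forall v i, same_class (l ^ v) (f v.+1 i) (f v i)) &
        (forall a : 'I_d -> nat -> int,
           (forall i v, (a i v.+1 = a i v %[mod (l ^ v)%N])%Z) ->
           (forall v, same_class (l ^ v)
              (fun I x t => \sum_(i < d) a i v * f v i I x t)
              (cech0 (U v) p)) ->
           forall i v, (a i v = 0 %[mod (l ^ v)%N])%Z)].

(* \sum_p (-1)^p b_p, where b_p is the largest d such that indep p d. *)
Definition alternating_sum (indep : nat -> nat -> Prop) : int :=
  xget 0 [set c : int | exists (b : nat -> nat) (m : nat),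
    [/\ (forall p, indep p (b p) /\ ~ indep p (b p).+1),
        (forall p, (m <= p)%N -> b p = 0%N) &
        c = \sum_(p < m) (-1) ^+ p * (b p)%:Z]].

Definition ladic_euler (k : fieldType) (l : nat) (X : variety k) : int :=
  alternating_sum (ladic_indep X l).

(******************************************************************************)
(*  Topological Euler characteristic over the complex numbers (singular       *)
(*  cohomology with rational coefficients, for the quotient topology)         *)
(******************************************************************************)

Definition top_open (C : numFieldType) (X : variety C) (A : set (point X)) :
    Prop :=
  exists2 V : set 'rV[C]_(adim X), open V &
    forall y, dom X y -> A (proj X y) <-> V y.

Definition simplex (R : realType) (p : nat) : set 'rV[R]_p.+1 :=
  [set x | (forall j, 0 <= x 0 j) /\ \sum_j x 0 j = 1].

Definition singular (R : realType) (C : numFieldType) (X : variety C) (p : nat)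
    (s : 'rV[R]_p.+1 -> point X) : Prop :=
  (forall x, simplex x -> exists2 y, dom X y & proj X y = s x) /\
  (forall A : set (point X), top_open A ->
     exists2 V : set 'rV[R]_p.+1, open V &
       forall x, simplex x -> A (s x) <-> V x).

Definition face (R : realType) (p : nat) (j : 'I_p.+2) (x : 'rV[R]_p.+1) :
    'rV[R]_p.+2 :=
  \row_l if unlift j l is Some l' then x 0 l' else 0.

Definition cochain (R : realType) (C : numFieldType) (X : variety C) (p : nat) : Type :=
  ('rV[R]_p.+1 -> point X) -> rat.

(* Singular simplices are represented by functions on R^(p+1), of which only
   the restriction to the standard simplex matters. *)
Definition cochain_ok (R : realType) (C : numFieldType) (X : variety C) (p : nat)
    (f : cochain R X p) : Prop :=
  forall s s' : 'rV[R]_p.+1 -> point X, singular s ->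
    (forall x, simplex x -> s x = s' x) -> f s = f s'.

Definition cochain_d (R : realType) (C : numFieldType) (X : variety C) (p : nat)
    (f : cochain R X p) : cochain R X p.+1 :=
  fun s => \sum_(j < p.+2) (-1) ^+ j * f (s \o face j).

Definition cocycle (R : realType) (C : numFieldType) (X : variety C) (p : nat)
    (f : cochain R X p) : Prop :=
  cochain_ok f /\ forall s, singular s -> cochain_d f s = 0.

Definition coboundary (R : realType) (C : numFieldType) (X : variety C) (p : nat) :
    cochain R X p -> Prop :=
  match p return cochain R X p -> Prop with
  | 0 => fun f => forall s, singular s -> f s = 0
  | p'.+1 => fun f => exists2 h : cochain R X p', cochain_ok h &
               forall s, singular s -> f s = cochain_d h s
  end.

(* dim H^p(X, Q) >= d. *)
Definition top_indep (R : realType) (C : numFieldType) (X : variety C) (p d : nat) : Prop :=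
  exists f : 'I_d -> cochain R X p,
    (forall i, cocycle (f i)) /\
    (forall a : 'I_d -> rat,
       coboundary (fun s => \sum_(i < d) a i * f i s) -> forall i, a i = 0).

Definition top_euler (R : realType) (C : numFieldType) (X : variety C) : int :=
  alternating_sum (top_indep R X).

(* Euler characteristics of varieties: l-adic over any algebraically
   closed field in which the prime l is invertible, topological over C. *)
Inductive euler_char : forall k : closedFieldType, (variety k -> int) -> Prop :=
| EulerLadic (k : closedFieldType) (l : nat) :
    prime l -> l%:R != 0 :> k -> @euler_char k (ladic_euler l)
| EulerTop (R : realType) : @euler_char R[i] (@top_euler R R[i]).

(******************************************************************************)
(*  Quiver Grassmannians and the Caldero-Chapoton map                         *)
(******************************************************************************)

(* The span of the n vectors of M whose coordinates, in a fixed basis of M, are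
   the rows of the n x dim M matrix encoded by y. *)
Definition frame_span (k : fieldType) (r : nat) (M : kQmod k r) (n : nat)
    (y : 'rV[k]_(n * \dim {:M})) : {vspace M} :=
  <<[seq (\sum_j vec_mx y i j *: (vbasis {:M})`_j)%R | i <- enum 'I_n]>>%VS.

(* Gr_e(M), as a quotient of the set of frames of submodules of dimension
   vector e. *)
Definition quiver_gr (k : fieldType) (r : nat) (M : kQmod k r)
    (e : {ffun 'I_r -> nat}) : variety k :=
  @Variety k {vspace M} ((\sum_i e i) * \dim {:M})
    [set y | [/\ row_free (vec_mx y), submodule (frame_span y) &
                 sub_dimv (frame_span y) = e]]
    (@frame_span k r M (\sum_i e i)).

(* Z[u^(+-1)] is realised inside its field of fractions. *)
Definition Zu (r : nat) : fieldType := {fraction (mpoly.mpoly r int)}.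

Definition u_ (r : nat) (i : 'I_r) : Zu r :=
  @FracField.tofrac (mpoly.mpoly r int) (mpoly.mpolyX int (mpoly.mnm1 i)).

Definition alpha (k : fieldType) (r : nat) (i : 'I_r) : {ffun 'I_r -> int} :=
  intv (dimv (simple_mod k i)).

Definition CC (k : fieldType) (r : nat) (chi : variety k -> int)
    (E : {ffun 'I_r -> int} -> {ffun 'I_r -> int} -> int) (M : kQmod k r) :
    Zu r :=
  \sum_(e \in [set: {ffun 'I_r -> nat}])
    (chi (quiver_gr M e))%:~R *
    \prod_(i < r)
      u_ i ^ (- E (intv e) (alpha k i)
              - E (alpha k i) (intv (dimv M) - intv e)).

(* P_n evaluated at x_1 = x 0, ..., x_n = x (n - 1). *)
Fixpoint chebyshev (A : comNzRingType) (n : nat) (x : nat -> A) : A :=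
  match n with
  | 0 => 1
  | 1 => x 0%N
  | (m.+1 as n').+1 => x n' * chebyshev n' x - chebyshev m x
  end.

(* Main.v *)
From HB Require Import structures.
From mathcomp Require Import all_boot all_order all_algebra.
From mathcomp Require Import complex.
From mathcomp Require Import -(notations) mpoly.
From mathcomp Require Import all_classical all_reals all_analysis.
From mathcomp Require Import zify ring.
Require Import Defs.

(** A module with socle S_i and length n is thin, with dimension vector the
    indicator function of [i, i + n), and its submodules form a chain, with
    exactly one submodule of dimension vector 1_[i, i+m) for each m <= n
    (serial_interval_mod, submodule_truncation). So each quiver Grassmannian of
    S_i^(n) is empty or a point, its Euler characteristic is 0 or 1, and the
    cluster character has n + 1 terms.

    With U_0 = 1, U_(j+1) = u_j for j < r and U_(r+1) = 1, the formula for the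
    Euler form makes the exponents telescope, and the term of the submodule of
    length m is U_i U_(i+n+1) / (U_(i+m) U_(i+m+1)). Hence (CC_interval)
      X_(S_i^(n)) = U_i U_(i+n+1) sum_(m=0)^n 1 / (U_(i+m) U_(i+m+1)),
    and X_(S_j) = (U_j + U_(j+2)) / U_(j+1) is the case n = 1. The right-hand
    sides satisfy the recursion of the Chebyshev polynomials (chebyshev_frieze).

    The Euler form is computed on projectives (euler_formE): homomorphisms from
    the projective P_i to N are the elements of N_i and Ext^1(P_i, N) = 0, so
    that <dim P_i, y> = y_i; and alpha_i = dim P_i - dim P_(i-1).

    The Euler characteristics are computed from the definitions
    (euler_char_empty, euler_char_pt). A point has one singular simplex in each
    degree. In the l-adic case, over an algebraically closed field every etale
    covering of a point is refined by the identity, since it has a section. In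
    both cases the complex of cochains becomes that of a point, with
    differentials 0, 1, 0, 1 and so on. *)

Set Implicit Arguments.
Unset Strict Implicit.
Unset Printing Implicit Defensive.

Import Order.TTheory GRing.Theory Num.Theory.

Local Open Scope classical_set_scope.
Local Open Scope ring_scope.

(** * Euler characteristics of the empty and of one-point varieties *)

(** The form in which Betti numbers of the empty variety (c = 0) and of a point
    (c = 1) are computed below. *)
Lemma alternating_sum_deg0 (indep : nat -> nat -> Prop) (c : nat) :
  (forall p d, indep p d <-> (d <= if p == 0%N then c else 0)%N) ->
  alternating_sum indep = c%:Z.
Proof.
move=> indepE; apply: xget_unique => [|_ [b [m [bP bm ->]]]].
  exists (fun p => if p == 0%N then c else 0%N), 1%N; split.
  - by move=> p; rewrite !indepE ltnn.
  - by case.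
  - by rewrite big_ord1 expr0 mul1r.
have bE p : b p = if p == 0%N then c else 0%N.
  by have [/indepE + /indepE/negP] := bP p; case: ifP => _; lia.
case: m bm => [bm | m _].
  by rewrite big_ord0; have := bm 0%N isT; rewrite bE => /= ->.
rewrite big_ord_recl big1 => [|j _]; rewrite bE /= ?mulr0 //.
by rewrite addr0 expr0 mul1r.
Qed.

Lemma sum_sign (A : pzRingType) (n : nat) :
  \sum_(j < n) (-1) ^+ j = (odd n)%:R :> A.
Proof.
elim: n => [|n IHn]; first by rewrite big_ord0.
by rewrite big_ord_recr IHn /= -signr_odd; case: (odd n); rewrite ?add0r ?subrr.
Qed.

(** There are no singular simplices, as a simplex is not empty. *)
Lemma top_indep_empty (R : realType) (C : numFieldType) (X : variety C)
    (p d : nat) :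
  (forall y, ~ dom X y) -> top_indep R X p d <-> (d <= 0)%N.
Proof.
move=> X0.
have sing0 q (s : 'rV[R]_q.+1 -> point X) : ~ singular s.
  case=> /(_ (delta_mx 0 0)) [|y /X0//]; split=> [j|].
    by rewrite mxE ler0n.
  rewrite (bigD1 0) //= !mxE eqxx big1 ?addr0 // => j /negbTE.
  by rewrite mxE => ->.
split=> [[f [_ indep]] | ].
  case: d f indep => // d f /(_ (fun=> 1)) H.
  suff /H/(_ ord0)/eqP : coboundary (fun s => \sum_i 1 * f i s) by rewrite oner_eq0.
  case: (p) f {H} => [|q] f /=; first by move=> s /sing0.
  by exists (fun=> 0) => [s s' /sing0 | s /sing0].
by case: d => // _; exists (fun _ _ => 0); split=> [[]|a _ []].
Qed.

Section TopPoint.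
Context (R : realType) (C : numFieldType) (X : variety C) (x0 : point X).
Hypothesis X_ne : exists y, dom X y.
Hypothesis X_pt : forall y, dom X y -> proj X y = x0.

(** Continuity is automatic for a constant map, so there is one singular simplex
    in each degree, up to its values outside the standard simplex. *)
Lemma singular_pt p (s : 'rV[R]_p.+1 -> point X) :
  singular s <-> forall x, simplex x -> s x = x0.
Proof.
split=> [[sX _] x xS | sE]; first by have [y yX <-] := sX x xS; exact: X_pt.
have [y yX] := X_ne; split=> [x /sE-> | A _]; first by exists y => //; apply: X_pt.
exists (if pselect (A x0) then setT else set0).
  by case: pselect => ? /=; [exact: openT | exact: open0].
by move=> x /sE->; case: pselect.
Qed.

Lemma face_simplex p (j : 'I_p.+2) (x : 'rV[R]_p.+1) :
  simplex x -> simplex (face j x).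
Proof.
case=> x_ge0 x_sum; split=> [l|]; first by rewrite mxE; case: unlift.
rewrite (bigD1_ord j) //= mxE unlift_none add0r -[RHS]x_sum.
by apply: eq_bigr => l _; rewrite mxE liftK.
Qed.

Lemma cochain_pt p (f : cochain R X p) s :
  cochain_ok f -> singular s -> f s = f (fun=> x0).
Proof. by move=> f_ok sS; apply: f_ok => // x; move/singular_pt: sS; apply. Qed.

(** All faces of the singular simplex of degree p + 1 agree, so the differential
    from degree p to p + 1 is multiplication by the alternating sum of p + 2
    ones: 0 if p is even and 1 if p is odd. *)
Lemma cochain_d_pt p (f : cochain R X p) s :
  cochain_ok f -> singular s -> cochain_d f s = (odd p)%:R * f (fun=> x0).
Proof.
move=> f_ok sS; rewrite -(negbK (odd p)) -(sum_sign _ p.+2) mulr_suml.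
apply: eq_bigr => j _; congr (_ * _); apply: cochain_pt => //.
by apply/singular_pt => x /(face_simplex j); move/singular_pt: sS; apply.
Qed.

Lemma cocycle_pt p (f : cochain R X p) :
  cocycle f <-> cochain_ok f /\ (odd p ==> (f (fun=> x0) == 0)).
Proof.
have pt_sing : singular (fun _ : 'rV[R]_p.+2 => x0) by apply/singular_pt.
split=> [[f_ok df0] | [f_ok f0]]; split=> //.
  apply/implyP=> p_odd; have := df0 _ pt_sing.
  by rewrite cochain_d_pt // p_odd mul1r => /eqP.
move=> s sS; rewrite cochain_d_pt //; case: odd f0 => /=; last by rewrite mul0r.
by move/eqP->; rewrite mulr0.
Qed.

Lemma coboundary_pt p (f : cochain R X p) :
  cochain_ok f ->
  coboundary f <-> ((p == 0%N) || odd p ==> (f (fun=> x0) == 0)).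
Proof.
have pt_sing q : singular (fun _ : 'rV[R]_q.+1 => x0) by apply/singular_pt.
case: p f => [|p] f f_ok /=.
  split=> [f0 | /eqP f0 s sS]; last by rewrite cochain_pt.
  by rewrite f0.
split=> [[h h_ok fE] | f0].
  apply/implyP => p_even; rewrite fE // cochain_d_pt // (negbTE p_even).
  by rewrite mul0r.
exists (fun=> f (fun=> x0)) => // s sS; rewrite cochain_d_pt // cochain_pt //.
case: (odd p) f0 => /=; first by rewrite mul1r.
by move/eqP->; rewrite mulr0.
Qed.

(** The complex of cochains is one copy of the rationals in each degree, with
    differentials 0, 1, 0, 1 and so on; its cohomology is the copy in degree 0. *)
Lemma top_indep_pt p d :
  top_indep R X p d <-> (d <= if p == 0%N then 1 else 0)%N.
Proof.
split=> [[f [f_cocycle f_indep]] | ].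
  pose c i := f i (fun=> x0).
  have indep (a : 'I_d -> rat) :
      (p == 0%N -> \sum_i a i * c i = 0) -> forall i, a i = 0.
    move=> a0; apply: f_indep; apply/coboundary_pt.
      move=> s s' sS ss'; apply: eq_bigr => i _; congr (_ * _).
      by have [f_ok _] := f_cocycle i; exact: f_ok.
    apply/implyP => /orP[/a0/eqP // | p_odd].
    rewrite big1 // => i _; have /cocycle_pt[_] := f_cocycle i.
    by rewrite p_odd => /eqP->; rewrite mulr0.
  case: p => [|p] /= in f f_cocycle f_indep c indep *; last first.
    case: d => // d in f f_cocycle f_indep c indep *.
    have H : p.+1 == 0%N -> \sum_i 1 * c i = 0 by [].
    by have /eqP := indep _ H ord0; rewrite oner_eq0.
  case: d => [|[|d]] // in f f_cocycle f_indep c indep *.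
  pose z : 'I_d.+2 := lift ord0 ord0.
  have c0 i : i = ord0 \/ i = z -> c i = 0.
    have := indep (fun i => if i == ord0 then c z else
                            if i == z then - c ord0 else 0).
    rewrite 2!big_ord_recl big1 => [|j _]; last by rewrite mul0r.
    rewrite /= addr0 mulNr mulrC subrr => /(_ (fun=> erefl)) H [] ->.
      by apply/eqP; rewrite -oppr_eq0; apply/eqP; exact: (H z).
    exact: (H ord0).
  have /(_ _ ord0)/eqP := indep (fun i => (i == ord0)%:R).
  rewrite eqxx oner_eq0 big_ord_recl big1 => [|j _]; last by rewrite mul0r.
  by rewrite mul1r addr0 c0; [move/(_ (fun=> erefl)) | left].
case: d => [_|[|d]]; last by case: p.
  by exists (fun _ _ => 0); split=> [[]|a _ []].
case: p => // _; exists (fun _ _ => 1); split=> [i|a].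
  by apply/cocycle_pt.
move=> a0 j; have := a0 (fun=> x0) (proj2 (singular_pt _) (fun _ _ => erefl)).
by rewrite big_ord1 mulr1 [j]ord1.
Qed.

End TopPoint.

Lemma peval1 (k : fieldType) (m q : nat) (y : 'rV[k]_m) (t : 'rV[k]_q) :
  peval 1 y t = 1.
Proof. exact: mpoly.meval1. Qed.

Lemma pevalC (k : fieldType) (m q : nat) (c : k) (y : 'rV[k]_m) (t : 'rV[k]_q) :
  peval (mpoly.mpolyC _ c) y t = c.
Proof. exact: mpoly.mevalC. Qed.

Lemma regular_cst (k : fieldType) (X : variety k) q D (c : k) :
  @regular k X q D (fun _ _ => c).
Proof.
move=> y t _ _; exists (mpoly.mpolyC _ c), 1.
by split=> [|y' t' _ _ _]; rewrite peval1 ?oner_eq0 // pevalC divr1.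
Qed.

Lemma loc_const_cst (k : fieldType) (X : variety k) q D (c : int) :
  @loc_const k X q D (fun _ _ => c).
Proof. by move=> y t _ _; exists 1; rewrite peval1 oner_eq0. Qed.

Lemma unit_chart_open (k : fieldType) (X : variety k) :
  zopen (setT : set (point X * 'rV[k]_1)).
Proof. by move=> y t _ _; exists 1; rewrite peval1 oner_eq0. Qed.

Lemma unit_chart_size (k : fieldType) (X : variety k) :
  exists d : nat, forall x : point X, (size ('X : {poly k}) <= d)%N.
Proof. by exists 2%N => _; rewrite size_polyX. Qed.

(** The chart given by the section t = 0 of X x A^1: an isomorphic copy of X. *)
Definition unit_chart (k : fieldType) (X : variety k) : chart X :=
  @Chart k X setT (fun=> 'X) (@unit_chart_open k X) (@unit_chart_size k X)
    (fun j => regular_cst _).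

Lemma in_unit_chart (k : fieldType) (X : variety k) x t :
  in_chart (unit_chart X) x t <-> t = 0.
Proof.
split=> [[_ /=] | ->]; first by rewrite hornerX.
by split=> //=; rewrite ?hornerX // derivX hornerC oner_eq0.
Qed.

Lemma unit_coveringP (k : fieldType) (X : variety k) y : dom X y ->
  exists (i : 'I_1) (t : k), in_chart (unit_chart X) (proj X y) t.
Proof. by exists ord0, 0; apply/in_unit_chart. Qed.

Definition unit_covering (k : fieldType) (X : variety k) : covering X :=
  @Covering k X 1 (fun=> unit_chart X) (@unit_coveringP k X).

(** The covering of the empty variety by no chart at all refines every covering. *)
Lemma same_class_empty (k : fieldType) (X : variety k) (U V : covering X)
    (p N : nat) (f : cech U p) (g : cech V p) :
  (forall y, ~ dom X y) -> same_class N f g.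
Proof.
move=> X0; have no q (Z : covering X) I x t : ~ overlap (U := Z) (p := q) I (x, t).
  by case=> -[y /X0].
pose W := @Covering k X 0 (fun=> unit_chart X) (fun y yX => False_ind _ (X0 y yX)).
have rho (Z : covering X) : refinement W Z.
  by exists (fun i : 'I_0 => False_rect _ (notF (ltn_ord i)))
            (fun _ _ _ => 0) => -[].
exists W, (rho U), (rho V).
case: p f g => [|p] f g; first by move=> I x t /no.
by exists (cech0 W p) => [I|I x t /no //]; exact: loc_const_cst.
Qed.

Lemma ladic_indep_empty (k : fieldType) (X : variety k) (l p d : nat) :
  prime l -> (forall y, ~ dom X y) -> ladic_indep X l p d <-> (d <= 0)%N.
Proof.
move=> l_pr X0; split=> [[U [f [_ _ indep]]] | ].
  case: d f indep => // d f /(_ (fun _ _ => 1) (fun _ _ => erefl)) H.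
  have /eqP := H (fun v => same_class_empty _ _ _ X0) ord0 1%N.
  by rewrite eqz_mod_dvd subr0 expn1 dvdz1 absz_nat; case: l l_pr {f H} => [|[]].
case: d => // _; exists (fun=> unit_covering X), (fun _ _ => cech0 _ p).
by split=> [v []|v []|a _ _ []].
Qed.

Section LadicPoint.
Context (k : fieldType) (X : variety k) (x0 : point X).
Hypothesis X_ne : exists y, dom X y.
Hypothesis X_pt : forall y, dom X y -> proj X y = x0.

Lemma overlap_pt (U : covering X) p (I : 'I_p.+1 -> 'I_(csize U)) x t :
  overlap I (x, t) <->
  x = x0 /\ forall j : 'I_p.+1, in_chart (U (I j)) x0 (t 0 j).
Proof.
split=> [[[y /X_pt/= yx0 yx] It] | [-> It]].
  have xE : x = x0 by rewrite -yx.
  by split=> // j; rewrite -xE; exact: It.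
by split=> //; have [y yX] := X_ne; exists y => //; exact: X_pt.
Qed.

Lemma covering_pt (U : covering X) :
  exists (i : 'I_(csize U)) (t : k), in_chart (U i) x0 t.
Proof. by have [y yX] := X_ne; rewrite -(X_pt yX); exact: coveringP. Qed.

(** Over a point, along repeated indices, the Cech differential is that of the
    singular cochains of a point. *)
Lemma cech_d_cst (U : covering X) p (f : cech U p) i t :
  cech_d f (fun=> i) x0 (const_mx t) =
  (odd p.+2)%:R * f (fun=> i) x0 (const_mx t).
Proof.
rewrite -(sum_sign _ p.+2) mulr_suml; apply: eq_bigr => j _.
by congr (_ * f _ _ _); apply/rowP => l; rewrite !mxE.
Qed.

(** A covering has a rational point over x0, and this is a section of one of its
    charts, as x0 is the only point of X. So the identity of X refines every
    covering, and cohomology classes may be compared on it. *)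
Lemma unit_refinement (U : covering X) :
  exists rho : refinement (unit_covering X) U,
  exists (i : 'I_(csize U)) (t : k), in_chart (U i) x0 t /\
    forall p (f : cech U p) I s,
      pullback rho f I x0 s = f (fun=> i) x0 (const_mx t).
Proof.
have [i [t it]] := covering_pt U.
have inP (j : 'I_1) x s :
    overlap (U := unit_covering X) (fun _ : 'I_1 => j) (x, s) -> in_chart (U i) x t.
  by case/overlap_pt=> ->.
exists (@Refinement k X (unit_covering X) U (fun=> i) (fun _ _ _ => t)
          (fun j => regular_cst t) inP), i, t; split=> // p f I s.
by congr (f _ _ _); apply/rowP => j; rewrite !mxE.
Qed.

(** On the identity covering of a point, the cochain f becomes the integer w
    that is its value along a repeated index. If p is odd, the cocycle condition
    says that w = 0 modulo N; if p > 0 is even, the constant w in degree p - 1 has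
    differential w. *)
Lemma same_class0_pt (U V : covering X) p N (f : cech U p) :
  cech_eq N (cech_d f) (cech0 U p.+1) ->
  (p = 0%N -> cech_eq N f (cech0 U p)) ->
  same_class N f (cech0 V p).
Proof.
move=> df0 f0.
have [rho [i [t [it rhoE]]]] := unit_refinement U.
have [tau _] := unit_refinement V.
exists (unit_covering X), rho, tau.
have it_pt q : overlap (U := U) (fun _ : 'I_q.+1 => i) (x0, const_mx t).
  by apply/overlap_pt; split=> // j; rewrite mxE.
have f_odd : odd p -> (f (fun=> i) x0 (const_mx t) = 0 %[mod N])%Z.
  move=> p_odd; have := df0 _ _ _ (it_pt p.+1).
  by rewrite cech_d_cst /= negbK p_odd mul1r.
case: p f df0 f0 f_odd => [|p] f df0 f0 f_odd /=.
  move=> I x s /overlap_pt[-> _]; rewrite rhoE [pullback tau _ _ _ _]/= subr0.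
  exact: f0.
exists (fun _ _ _ => f (fun=> i) x0 (const_mx t)) => [I|I x s /overlap_pt[-> _]].
  exact: loc_const_cst.
rewrite rhoE subr0 /cech_d -mulr_suml sum_sign /= negbK.
have [_ | /f_odd->] := boolP (odd p); first by rewrite mul1r.
by rewrite mul0r.
Qed.

(** The differential of a cochain of degree 0 compares its values on any two
    charts. *)
Lemma cocycle0_const (U : covering X) N (f : cech U 0) I x t I' x' t' :
  cech_eq N (cech_d f) (cech0 U 1) -> overlap I (x, t) -> overlap I' (x', t') ->
  (f I x t = f I' x' t' %[mod N])%Z.
Proof.
move=> df0 /overlap_pt[-> It] /overlap_pt[-> It'].
pose J (j : 'I_2) := if j == ord0 then I' ord0 else I ord0.
pose s : 'rV[k]_2 := \row_j if j == ord0 then t' 0 ord0 else t 0 ord0.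
have Js : overlap J (x0, s).
  by apply/overlap_pt; split=> // j; rewrite /J mxE; case: eqP.
have := df0 _ _ _ Js; rewrite /cech_d big_ord_recl big_ord1 expr0 mul1r mulN1r.
have -> : (fun l => J (lift ord0 l)) = I by apply/funext => l; rewrite [l]ord1.
have -> : (fun l => J (lift (lift ord0 ord0) l)) = I'.
  by apply/funext => l; rewrite [l]ord1.
have -> : col' ord0 s = t by apply/rowP => l; rewrite [l]ord1 !mxE.
have -> : col' (lift ord0 ord0) s = t' by apply/rowP => l; rewrite [l]ord1 !mxE.
by move/eqP; rewrite eqz_mod_dvd subr0 -eqz_mod_dvd => /eqP.
Qed.

Lemma cech_d_sum (U : covering X) p d (a : 'I_d -> int) (f : 'I_d -> cech U p)
    N :
  (forall i, cech_eq N (cech_d (f i)) (cech0 U p.+1)) ->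
  cech_eq N (cech_d (fun I x t => \sum_i a i * f i I x t)) (cech0 U p.+1).
Proof.
move=> df0 I x t It; apply/eqP; rewrite eqz_mod_dvd subr0.
have -> : cech_d (fun I x t => \sum_i a i * f i I x t) I x t =
          \sum_i a i * cech_d (f i) I x t.
  rewrite /cech_d; under eq_bigr do rewrite mulr_sumr.
  rewrite exchange_big; apply: eq_bigr => i _; rewrite mulr_sumr.
  by apply: eq_bigr => j _; ring.
apply: rpred_sum => i _; apply: dvdz_mull.
by rewrite -[cech_d _ _ _ _]subr0 -eqz_mod_dvd; apply/eqP; exact: df0.
Qed.

Lemma refinement_overlap (W U : covering X) (rho : refinement W U) p
    (I : 'I_p.+1 -> 'I_(csize W)) x t :
  overlap I (x, t) ->
  overlap (fun j => rindex rho (I j))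
          (x, \row_j rmap rho (I j) x (const_mx (t 0 j))).
Proof.
move=> /overlap_pt[-> It]; apply/overlap_pt; split=> // j; rewrite mxE.
by apply/rmapP/overlap_pt; split=> // l; rewrite mxE.
Qed.

(** Classes of positive degree vanish, so that they satisfy the relation with all
    coefficients 1. In degree 0 a system of compatible classes is an l-adic
    integer, and two l-adic integers c_0, c_1 satisfy the relation
    c_1 c_0 - c_0 c_1 = 0, which is nontrivial unless both vanish. The constant
    class 1 is not torsion. *)
Lemma ladic_indep_pt l p d : prime l ->
  ladic_indep X l p d <-> (d <= if p == 0%N then 1 else 0)%N.
Proof.
move=> l_pr; have one_neq0 : ~ (1 = 0 %[mod (l ^ 1)%N])%Z.
  move/eqP; rewrite eqz_mod_dvd subr0 expn1 dvdz1 absz_nat.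
  by case: l l_pr => [|[]].
split=> [[U [f [f_cocycle f_compat f_indep]]] | ].
  case: p => [|p] /= in f f_cocycle f_compat f_indep *; last first.
    case: d => // d in f f_cocycle f_compat f_indep *.
    apply: (False_ind _ (one_neq0 _)).
    apply: (f_indep (fun _ _ => 1) _ _ ord0 1%N) => //.
    move=> v; apply: same_class0_pt => //.
    by apply: cech_d_sum => i; have [] := f_cocycle v i.
  have pt_ex v : exists s : 'I_(csize (U v)) * k, in_chart (U v s.1) x0 s.2.
    by have [i [t it]] := covering_pt (U v); exists (i, t).
  (* c j v is the class modulo l ^ v of the j-th system, read at one point s v of
     the covering of level v. *)
  pose s v := sval (cid (pt_ex v)).
  pose c j v := f v j (fun=> (s v).1) x0 (const_mx (s v).2).
  have cP j v I x t : overlap I (x, t) -> (f v j I x t = c j v %[mod (l ^ v)%N])%Z.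
    move=> It; apply: cocycle0_const => //; first by have [] := f_cocycle v j.
    by apply/overlap_pt; split=> // i; rewrite mxE; exact: svalP (cid (pt_ex v)).
  have c_compat j v : (c j v.+1 = c j v %[mod (l ^ v)%N])%Z.
    have [W [rho [tau /=]]] := f_compat v j.
    have [i [t it]] := covering_pt W.
    have It : overlap (U := W) (fun _ : 'I_1 => i) (x0, const_mx t).
      by apply/overlap_pt; split=> // m; rewrite mxE.
    move=> /(_ _ _ _ It) /eqP; rewrite eqz_mod_dvd subr0 -eqz_mod_dvd => /eqP fE.
    rewrite -(cP j v _ _ _ (refinement_overlap tau It)) -fE; apply/eqP.
    rewrite eq_sym eqz_mod_dvd.
    apply: (@dvdz_trans (l ^ v.+1)%N); first by rewrite dvdzE !absz_nat dvdn_exp2l.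
    by rewrite -eqz_mod_dvd; apply/eqP; exact: cP (refinement_overlap rho It).
  have indep (a : 'I_d -> nat -> int) :
      (forall i v, (a i v.+1 = a i v %[mod (l ^ v)%N])%Z) ->
      (forall v, (\sum_i a i v * c i v = 0 %[mod (l ^ v)%N])%Z) ->
      forall i v, (a i v = 0 %[mod (l ^ v)%N])%Z.
    move=> a_compat a0; apply: f_indep => // v.
    apply: same_class0_pt => [|_ I x t It].
      by apply: cech_d_sum => i; have [] := f_cocycle v i.
    rewrite -[RHS](a0 v); apply/eqP; rewrite eqz_mod_dvd -sumrB.
    apply: rpred_sum => i _; rewrite -mulrBr dvdz_mull // -eqz_mod_dvd.
    exact/eqP/cP.
  case: d => [|[|d]] // in f f_cocycle f_compat f_indep c cP c_compat indep *.
  pose z : 'I_d.+2 := lift ord0 ord0.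
  have c0 i : i = ord0 \/ i = z -> forall v, (c i v = 0 %[mod (l ^ v)%N])%Z.
    (* The relation between c_0 and c_1 that always holds. *)
    pose a i v := if i == ord0 then c z v else if i == z then - c ord0 v else 0.
    have H : forall i v, (a i v = 0 %[mod (l ^ v)%N])%Z.
      apply: indep => [j v|v].
        rewrite /a; case: ifP => // _; case: ifP => // _.
        by rewrite -modzNm (c_compat _ v) modzNm.
      rewrite 2!big_ord_recl big1 => [|j _]; last by rewrite mul0r.
      by rewrite /a /= addr0 mulNr mulrC subrr.
    case=> -> v; last exact: (H ord0).
    apply/eqP; have /eqP := H z v; rewrite !eqz_mod_dvd !subr0 /a /=.
    by rewrite rpredN.
  apply: (False_ind _ (one_neq0 _)).
  have := indep (fun i _ => (i == ord0)%:R) (fun _ _ => erefl) _ ord0 1%N; apply.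
  move=> v; rewrite big_ord_recl big1 => [|j _]; last by rewrite mul0r.
  by rewrite mul1r addr0 c0 //; left.
case: d => [_|[|d]]; last by case: p.
  exists (fun=> unit_covering X), (fun _ _ => cech0 _ p).
  by split=> [v []|v []|a _ _ []].
case: p => // _; exists (fun=> unit_covering X), (fun _ _ _ _ _ => 1); split.
- move=> v i; split=> [I|I x t _]; first exact: loc_const_cst.
  by rewrite /cech_d -mulr_suml sum_sign mul0r.
- move=> v i; have [rho _] := unit_refinement (unit_covering X).
  by exists (unit_covering X), rho, rho => I x t _; rewrite /pullback subrr.
move=> a _ a0 i v; have [W [rho [tau /=]]] := a0 v.
have [j [t jt]] := covering_pt W.
have Jt : overlap (U := W) (fun _ : 'I_1 => j) (x0, const_mx t).
  by apply/overlap_pt; split=> // m; rewrite mxE.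
by move=> /(_ _ _ _ Jt); rewrite (ord1 i) /pullback /cech0 big_ord1 mulr1 subr0.
Qed.

End LadicPoint.

Lemma euler_char_empty (k : closedFieldType) (chi : variety k -> int)
    (X : variety k) :
  euler_char chi -> (forall y, ~ dom X y) -> chi X = 0.
Proof.
move=> chiP; case: chiP X => [k0 l l_pr _ | R] X X0;
  apply: (@alternating_sum_deg0 _ 0) => p d; rewrite if_same.
- exact: ladic_indep_empty.
- exact: top_indep_empty.
Qed.

Lemma euler_char_pt (k : closedFieldType) (chi : variety k -> int)
    (X : variety k) (x0 : point X) :
  euler_char chi -> (exists y, dom X y) ->
  (forall y, dom X y -> proj X y = x0) -> chi X = 1.
Proof.
move=> chiP; case: chiP X x0 => [k0 l l_pr _ | R] X x0 X_ne X_pt;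
  apply: (@alternating_sum_deg0 _ 1) => p d.
- exact: (ladic_indep_pt X_ne X_pt).
- exact: (@top_indep_pt R (complex R) X x0 X_ne X_pt).
Qed.

(** * Modules and the indecomposable projectives *)

Section Modules.
Context (k : fieldType) (r : nat).
Implicit Types (M N : kQmod k r) (a : arrow r).

Lemma linfunE (U V : vectType k) (f : U -> V) : linear f -> linfun f =1 f.
Proof.
move=> f_lin x; pose F : {linear U -> V} :=
  HB.pack f (GRing.isLinear.Build _ _ _ _ f f_lin).
exact: (lfunE F).
Qed.

Lemma hom_spaceP M N (f : 'Hom(M, N)) : reflect (is_hom f) (f \in hom_space M N).
Proof.
have linC (g : 'End(M)) (h : 'End(N)) :
    linear (fun f : 'Hom(M, N) => (f \o g)%VF - (h \o f)%VF).
  move=> c x y; apply/lfunP => v.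
  rewrite !(add_lfunE, opp_lfunE, scale_lfunE, comp_lfunE) linearP.
  by rewrite scalerBr opprD addrACA.
have kerE (g : 'End(M)) (h : 'End(N)) :
   (f \in lker (linfun (fun f : 'Hom(M, N) => (f \o g)%VF - (h \o f)%VF))) =
   ((f \o g)%VF == (h \o f)%VF).
  by rewrite memv_ker linfunE // subr_eq0.
rewrite /hom_space memv_cap; apply: (iffP andP) => [[fI fA] | [fI fA]].
  split=> [i | a].
    by move/subv_bigcapP: fI => /(_ i isT); rewrite -memvE kerE => /eqP.
  by move/subv_bigcapP: fA => /(_ a isT); rewrite -memvE kerE => /eqP.
by split; apply/subv_bigcapP => x _; rewrite -memvE kerE ?fI ?fA eqxx.
Qed.

End Modules.

(** The matrix unit with index in nat, zero outside the range: both idempotents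
    and arrows of the projective at i are matrix units of size i + 1. *)
Definition unit_mx (k : fieldType) (n p q : nat) : 'M[k]_n :=
  \matrix_(l, m) ((l == p :> nat) && (m == q :> nat))%:R.

Lemma unit_mxM (k : fieldType) (n p q p' q' : nat) :
  unit_mx k n p q *m unit_mx k n p' q' =
  if (q == p') && (q < n)%N then unit_mx k n p q' else 0.
Proof.
apply/matrixP => l m; rewrite !mxE.
have [q_lt | q_ge] := ltnP q n; last first.
  rewrite andbF mxE big1 // => j _; rewrite !mxE.
  have := ltn_ord j; case: (eqVneq (j : nat) q) => [->|];
    by rewrite ?andbF ?mul0r //; lia.
rewrite (bigD1 (Ordinal q_lt)) //= big1 ?addr0 => [|j jq]; last first.
  rewrite !mxE; have -> : (j == q :> nat) = false.
    by apply: contra_neqF jq => /eqP jq; exact: val_inj.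
  by rewrite andbF mul0r.
by rewrite !mxE eqxx !andbT; case: (q == p'); rewrite ?mxE /= ?mulr0 // -natrM mulnb.
Qed.

Lemma unit_mx_eq0 (k : fieldType) (n p q : nat) :
  (n <= p)%N || (n <= q)%N -> unit_mx k n p q = 0.
Proof.
move=> out; apply/matrixP => l m; rewrite !mxE.
by have := ltn_ord l; have := ltn_ord m; case: eqP; case: eqP => //; lia.
Qed.

Section Projective.
Context (k : fieldType) (r : nat) (i : 'I_r).

Let n := i.+1.
Let mulr_mx (A : 'M[k]_n) : 'End('rV[k]_n) := linfun (mulmxr A).

Let proj_idem (j : 'I_r) := mulr_mx (unit_mx k n j j).
Let proj_act (a : arrow r) := mulr_mx (unit_mx k n (src a) (tgt a)).

Let mulr_mxM A B : (mulr_mx A \o mulr_mx B)%VF = mulr_mx (B *m A).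
Proof. by apply/lfunP => v; rewrite comp_lfunE !lfunE /= mulmxA. Qed.

Let mulr_mx0 : mulr_mx 0 = 0.
Proof. by apply/lfunP => v; rewrite lfunE zero_lfunE /= mulmx0. Qed.

Lemma proj_idemM (j l : 'I_r) :
  (proj_idem j \o proj_idem l)%VF = if j == l then proj_idem j else 0.
Proof.
rewrite mulr_mxM unit_mxM [l == j :> nat]eq_sym (inj_eq val_inj).
case: eqVneq => [<-|]; last by rewrite mulr_mx0.
have [//|ge] := ltnP j n; rewrite /proj_idem unit_mx_eq0 //; by rewrite ge.
Qed.

Lemma proj_idem_sum : \sum_(j < r) proj_idem j = \1%VF.
Proof.
apply/lfunP => v; rewrite sum_lfunE id_lfunE.
under eq_bigr do rewrite lfunE /=.
rewrite -mulmx_sumr; suff -> : \sum_(j < r) unit_mx k n j j = 1%:M by rewrite mulmx1.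
apply/matrixP => l m; rewrite summxE !mxE.
have l_lt : (l < r)%N by have := ltn_ord l; have := ltn_ord i; rewrite /n; lia.
rewrite (bigD1 (Ordinal l_lt)) //= big1 ?addr0 => [|j jl]; rewrite !mxE.
  by rewrite /= eqxx eq_sym.
have -> // : (l == j :> nat) = false.
by apply: contra_neqF jl => /eqP jq; exact: val_inj.
Qed.

Lemma proj_act_src a : (proj_act a \o proj_idem (src a))%VF = proj_act a.
Proof.
rewrite mulr_mxM unit_mxM eqxx /=.
by have [//|ge] := ltnP (src a) n; rewrite /proj_act unit_mx_eq0 // ge.
Qed.

Lemma proj_act_tgt a : (proj_idem (tgt a) \o proj_act a)%VF = proj_act a.
Proof.
rewrite mulr_mxM unit_mxM eqxx /=.
by have [//|ge] := ltnP (tgt a) n; rewrite /proj_act unit_mx_eq0 // ge orbT.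
Qed.

(** The projective cover P_i of the simple module at i. It has a basis of vectors
    proj_vec i l for l <= i, the paths from i to l; the arrows from l + 1 to l
    act as shifts. *)
Definition proj_mod : kQmod k r :=
  KQmod proj_idemM proj_idem_sum proj_act_src proj_act_tgt.

Definition proj_vec (l : nat) : proj_mod := \row_m (m == l :> nat)%:R : 'rV[k]_n.

Lemma proj_vec_unit_mx l p q :
  (\row_(m < n) (m == l :> nat)%:R) *m unit_mx k n p q =
  if (l == p) && (l < n)%N then \row_(m < n) (m == q :> nat)%:R else 0.
Proof.
have row_unit_mx s : \row_(m < n) (m == s :> nat)%:R = row ord0 (unit_mx k n 0 s).
  by apply/rowP => m; rewrite !mxE.
by rewrite !row_unit_mx -row_mul unit_mxM; case: ifP => // _; rewrite row0.
Qed.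

Lemma proj_vec_span (v : proj_mod) :
  v = \sum_(l < n) (v : 'rV[k]_n) ord0 l *: proj_vec l.
Proof.
apply/rowP => m; rewrite summxE (bigD1 m) //= big1 => [|l lm]; rewrite !mxE.
  by rewrite eqxx mulr1 addr0.
have -> : (m == l :> nat) = false.
  by apply: contra_neqF lm => /eqP lm; exact: val_inj.
by rewrite mulr0.
Qed.

Lemma idem_proj_vec (j : 'I_r) l : (l < n)%N ->
  idem proj_mod j (proj_vec l) = if l == j then proj_vec l else 0.
Proof.
move=> l_lt; rewrite lfunE /= proj_vec_unit_mx l_lt andbT.
by case: eqP => [<-|].
Qed.

Lemma act_proj_vec (a : arrow r) l : (l < n)%N ->
  act proj_mod a (proj_vec l) = if l == src a then proj_vec (tgt a) else 0.
Proof. by move=> l_lt; rewrite lfunE /= proj_vec_unit_mx l_lt andbT. Qed.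
End Projective.

Section Paths.
Context (k : fieldType) (r : nat).
Implicit Types (N : kQmod k r) (a b : arrow r) (i j : 'I_r).

Lemma src_tgt a : src a = (tgt a).+1 :> nat.
Proof. exact/eqP/(valP a). Qed.

Lemma src_inj a b : src a = src b -> a = b.
Proof.
move=> ab; have tab : tgt a = tgt b.
  by apply/val_inj/succn_inj; rewrite -!src_tgt ab.
apply/val_inj; rewrite [val a]surjective_pairing [RHS]surjective_pairing.
by congr pair.
Qed.

Lemma arrow_from i l : i = l.+1 :> nat -> exists a, src a = i /\ tgt a = l :> nat.
Proof.
move=> il; have l_lt : (l < r)%N by have := ltn_ord i; lia.
have il' : (i, Ordinal l_lt).1 == (i, Ordinal l_lt).2.+1 :> nat by exact/eqP.
by exists (exist _ (i, Ordinal l_lt) il').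
Qed.

Lemma idem_idem N i j x : idem N i (idem N j x) = if i == j then idem N i x else 0.
Proof. by rewrite -comp_lfunE idemM; case: eqP => // _; rewrite zero_lfunE. Qed.

Lemma act_idem N a j x :
  act N a (idem N j x) = if j == src a then act N a x else 0.
Proof.
by rewrite -[in LHS](act_src N a) comp_lfunE idem_idem eq_sym; case: eqP => _;
  rewrite ?linear0 // -comp_lfunE act_src.
Qed.

Lemma idem_act N a j x :
  idem N j (act N a x) = if j == tgt a then act N a x else 0.
Proof.
by rewrite -[in LHS](act_tgt N a) comp_lfunE idem_idem; case: eqP => [->|_];
  rewrite // -comp_lfunE act_tgt.
Qed.

(** Each vertex is the source of at most one arrow, so on homogeneous vectors the
    sum of all arrows acts as the only arrow that starts there; its powers are
    the paths. *)
Definition arrow_sum N : 'End(N) := \sum_a act N a.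

Lemma arrow_sumE N a x : idem N (src a) x = x -> arrow_sum N x = act N a x.
Proof.
move=> xE; rewrite sum_lfunE (bigD1 a) //= big1 ?addr0 // => b ba.
rewrite -xE act_idem; case: eqP => // /src_inj ab.
by rewrite ab eqxx in ba.
Qed.

Lemma idem_path N i x s j : idem N i x = x -> (s <= i)%N ->
  idem N j (iter s (arrow_sum N) x) =
  if (j + s == i)%N then iter s (arrow_sum N) x else 0.
Proof.
move=> xE; elim: s j => [|s IHs] j s_le.
  by rewrite addn0 -[in LHS]xE idem_idem (inj_eq val_inj); case: eqP => // ->.
have s_lt : (i - s < r)%N by have := ltn_ord i; lia.
have [a [aE tE]] := @arrow_from (Ordinal s_lt) (i - s).-1 ltac:(rewrite /=; lia).
rewrite iterS (@arrow_sumE _ a) ?idem_act; last first.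
  by rewrite IHs ?aE ?(ltnW s_le) //= subnK ?eqxx // ltnW.
congr (if _ then _ else _); rewrite -(inj_eq val_inj) /= tE; lia.
Qed.

Lemma act_path N i x s a : idem N i x = x -> (s <= i)%N ->
  act N a (iter s (arrow_sum N) x) =
  if (src a + s == i)%N then iter s.+1 (arrow_sum N) x else 0.
Proof.
move=> xE s_le; have := idem_path (src a) xE s_le.
case: eqP => _ iE; first by rewrite iterS (@arrow_sumE _ a).
by have := act_idem a (src a) (iter s (arrow_sum N) x); rewrite eqxx iE linear0.
Qed.

Lemma proj_hom_ext i (V : vectType k) (f g : 'Hom(proj_mod k i, V)) :
  (forall l, (l <= i)%N -> f (proj_vec k i l) = g (proj_vec k i l)) -> f = g.
Proof.
move=> fg; apply/lfunP => v; rewrite [v]proj_vec_span !linear_sum.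
apply: eq_bigr => l _; rewrite !linearZ /= fg //; have := ltn_ord l; lia.
Qed.

(** P_i is generated by the trivial path at i. *)
Lemma proj_hom_eq i N (f g : 'Hom(proj_mod k i, N)) :
  is_hom f -> is_hom g -> f (proj_vec k i i) = g (proj_vec k i i) -> f = g.
Proof.
move=> [_ fA] [_ gA] fg; apply: proj_hom_ext.
suff H s : (s <= i)%N -> f (proj_vec k i (i - s)) = g (proj_vec k i (i - s)).
  by move=> l l_le; rewrite -(subKn l_le) H // leq_subr.
elim: s => [|s IHs] s_le; first by rewrite subn0.
have s_lt : (i - s < r)%N by have := ltn_ord i; lia.
have [a [aE tE]] := @arrow_from (Ordinal s_lt) (i - s.+1) ltac:(rewrite /=; lia).
have <- : act (proj_mod k i) a (proj_vec k i (i - s)) = proj_vec k i (i - s.+1).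
  by rewrite act_proj_vec ?aE ?eqxx ?tE //; lia.
by rewrite -!comp_lfunE fA gA !comp_lfunE IHs // ltnW.
Qed.

(** P_i is free on the trivial path at i: the image of the path from i to l is
    forced to be that path applied to x. *)
Lemma proj_hom_exists i N x : idem N i x = x ->
  exists2 f : 'Hom(proj_mod k i, N), is_hom f & f (proj_vec k i i) = x.
Proof.
move=> xE; pose g (v : 'rV[k]_i.+1) :=
  \sum_(l < i.+1) v 0 l *: iter (i - l) (arrow_sum N) x.
have g_lin : linear g.
  move=> c u v; rewrite /g scaler_sumr -big_split; apply: eq_bigr => l _.
  by rewrite !mxE scalerDl scalerA.
have gE l : (l <= i)%N -> linfun g (proj_vec k i l) = iter (i - l) (arrow_sum N) x.
  move=> l_le; have l_lt : (l < i.+1)%N by [].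
  rewrite linfunE // /g (bigD1 (Ordinal l_lt)) //= big1 => [|m ml]; rewrite mxE.
    by rewrite eqxx scale1r addr0.
  have -> : (m == l :> nat) = false.
    by apply: contra_neqF ml => /eqP ml; exact: val_inj.
  by rewrite scale0r.
exists (linfun g : 'Hom(proj_mod k i, N)); last by rewrite gE // subnn.
split=> [j | a]; apply: proj_hom_ext => l l_le; rewrite !comp_lfunE.
  rewrite idem_proj_vec // gE // (idem_path _ xE) ?leq_subr //.
  have -> : (j + (i - l) == i)%N = (l == j :> nat) by lia.
  by case: eqP => _; rewrite ?gE // linear0.
rewrite act_proj_vec // gE // (act_path _ xE) ?leq_subr //; have aE := src_tgt a.
have -> : (src a + (i - l) == i)%N = (l == src a :> nat) by lia.
case: eqP => [lE|_]; last by rewrite linear0.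
by rewrite gE; [congr (iter _ _ _)|]; lia.
Qed.

End Paths.

(** * The Euler form *)

Section EulerForm.
Context (k : fieldType) (r : nat).
Implicit Types (N : kQmod k r) (a b : arrow r) (i j : 'I_r).

Lemma hom_comp (A B C : kQmod k r) (g : 'Hom(B, C)) (f : 'Hom(A, B)) :
  is_hom g -> is_hom f -> is_hom (g \o f)%VF.
Proof.
move=> [gI gA] [fI fA]; split=> [j|a].
  by rewrite -comp_lfunA fI comp_lfunA gI comp_lfunA.
by rewrite -comp_lfunA fA comp_lfunA gA comp_lfunA.
Qed.

Lemma hom_idem (A B : kQmod k r) (f : 'Hom(A, B)) i x :
  is_hom f -> f (idem A i x) = idem B i (f x).
Proof. by case=> fI _; rewrite -!comp_lfunE fI. Qed.

(** Lift the image of the generator, make the lift homogeneous, extend. *)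
Lemma proj_mod_projective i : projective_mod (proj_mod k i).
Proof.
move=> A B g f g_hom f_hom g_onto.
have /memv_imgP[y _ fE] : f (proj_vec k i i) \in limg g by rewrite g_onto memvf.
have yE : idem A i (idem A i y) = idem A i y by rewrite idem_idem eqxx.
have [h h_hom hE] := proj_hom_exists yE.
exists h; split=> //; apply: proj_hom_eq => //; first exact: hom_comp.
rewrite comp_lfunE hE (hom_idem _ _ g_hom) -fE -(hom_idem _ _ f_hom).
by rewrite idem_proj_vec ?eqxx.
Qed.

(** Yoneda: evaluation at the generator identifies Hom(P_i, N) with N_i. *)
Lemma dim_hom_proj i N : \dim (hom_space (proj_mod k i) N) = dimv N i.
Proof.
pose ev (f : 'Hom(proj_mod k i, N)) := f (proj_vec k i i).
have ev_lin : linear ev by move=> c f g; rewrite /ev add_lfunE scale_lfunE.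
rewrite ffunE -(@limg_dim_eq _ _ _ (linfun ev)); last first.
  apply/eqP; rewrite -subv0; apply/subvP => f; rewrite memv_cap memv_ker memv0.
  rewrite linfunE // => /andP[/hom_spaceP f_hom /eqP f0]; apply/eqP.
  apply: proj_hom_eq => //; last by rewrite [LHS]f0 zero_lfunE.
  by split=> *; rewrite comp_lfun0l comp_lfun0r.
congr (\dim _); apply/eqP; rewrite eqEsubv; apply/andP; split; apply/subvP => x.
  case/memv_imgP=> f /hom_spaceP f_hom ->; rewrite linfunE // /ev.
  have eE : idem (proj_mod k i) i (proj_vec k i i) = proj_vec k i i.
    by rewrite idem_proj_vec ?eqxx.
  by rewrite -eE (hom_idem _ _ f_hom) memv_img ?memvf.
case/memv_imgP=> y _ ->.
have yE : idem N i (idem N i y) = idem N i y by rewrite idem_idem eqxx.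
have [h /hom_spaceP h_hom hE] := proj_hom_exists yE.
by rewrite -hE -[h _]/(ev h) -(linfunE ev_lin) memv_img.
Qed.

Lemma zero_idem_sum : \sum_(i < r) (0 : 'End('rV[k]_0)) = \1%VF.
Proof. by apply/lfunP => v; rewrite [v]thinmx0 !linear0. Qed.

Definition zero_mod : kQmod k r :=
  @KQmod k r 'rV[k]_0 (fun=> 0) (fun=> 0)
    (fun i j => etrans (comp_lfun0l _ _) (esym (if_same (i == j) _)))
    zero_idem_sum (fun=> comp_lfun0l _ _) (fun=> comp_lfun0r _ _).

(** The presentation of P_i by itself, with zero kernel. *)
Lemma ext1_proj i N : is_dim_ext1 (proj_mod k i) N 0.
Proof.
exists zero_mod, (proj_mod k i), 0, \1%VF; split; split=> //.
- by split=> *; rewrite comp_lfun0l comp_lfun0r.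
- by split=> *; rewrite comp_lfun1l comp_lfun1r.
- exact: proj_mod_projective.
- by apply/eqP; rewrite -subv0; apply/subvP => v _; rewrite memv0 [v]thinmx0.
- have /eqP-> : lker (\1%VF : 'End(proj_mod k i)) == 0%VS.
    by apply/lker0P => x y; rewrite !id_lfunE.
  apply/eqP; rewrite -subv0; apply/subvP => v /memv_imgP[x _ ->].
  by rewrite zero_lfunE memv0.
- exact: lim1g.
suff -> : hom_space zero_mod N = 0%VS by rewrite dimv0.
apply/eqP; rewrite -subv0; apply/subvP => f _; rewrite memv0; apply/eqP/lfunP => v.
by rewrite [v]thinmx0 !linear0.
Qed.

Lemma dimv_proj i j : dimv (proj_mod k i) j = (j <= i)%N.
Proof.
rewrite ffunE; suff -> : (limg (idem (proj_mod k i) j) = <[proj_vec k i j]>)%VS.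
  rewrite dim_vline; congr nat_of_bool; have [ji | ij] := leqP j i.
    apply/eqP => /rowP/(_ (inord j)); rewrite !mxE inordK // eqxx => /eqP.
    by rewrite oner_eq0.
  apply/negbF/eqP/rowP => m; rewrite !mxE.
  by have -> : (m == j :> nat) = false by have := ltn_ord m; lia.
apply/eqP; rewrite eqEsubv -memvE; apply/andP; split.
  apply/subvP => _ /memv_imgP[v _ ->]; rewrite [v]proj_vec_span linear_sum.
  apply: memv_suml => l _; rewrite linearZ /= idem_proj_vec //.
  by case: eqP => [->|_]; rewrite ?scaler0 ?mem0v // memvZ // memv_line.
have [ji | ij] := leqP j i.
  by apply/memv_imgP; exists (proj_vec k i j); rewrite ?memvf // idem_proj_vec ?eqxx.
suff -> : proj_vec k i j = 0 by rewrite mem0v.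
apply/rowP => m; rewrite !mxE.
by have -> : (m == j :> nat) = false by have := ltn_ord m; lia.
Qed.

Lemma dimv_simple i j : dimv (simple_mod k i) j = (i == j).
Proof.
rewrite ffunE /= /simple_idem; case: eqP => _; last by rewrite lim0g dimv0.
by rewrite lim1g dimvf.
Qed.

End EulerForm.

Section EulerFormula.
Context (k : fieldType) (r : nat).
Implicit Types (x y : {ffun 'I_r -> int}) (a : arrow r) (i j : 'I_r).

Lemma intvE (e : {ffun 'I_r -> nat}) i : intv e i = (e i)%:Z.
Proof. by rewrite /intv ffunE. Qed.

Lemma alphaE i j : alpha k i j = (i == j)%:Z.
Proof. by rewrite intvE dimv_simple. Qed.

Lemma intv_proj i : intv (dimv (proj_mod k i)) = [ffun j : 'I_r => (j <= i)%N%:Z].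
Proof. by apply/ffunP => j; rewrite intvE dimv_proj ffunE. Qed.

(** The radical of P_i is the projective at the end of the arrow that starts at
    i, if there is one. *)
Lemma alpha_proj i :
  alpha k i = intv (dimv (proj_mod k i)) -
              \sum_(a | src a == i) intv (dimv (proj_mod k (tgt a))).
Proof.
under eq_bigr do rewrite intv_proj.
rewrite intv_proj; apply/ffunP => j.
rewrite alphaE !ffunE sum_ffunE -(inj_eq val_inj) /=.
have [[a /eqP ai] | no_arrow] := pselect (exists a, src a == i).
  rewrite (big_pred1 a) => [|b]; last first.
    by apply/eqP/eqP => [bi | ->//]; apply: src_inj; rewrite bi.
  by rewrite !ffunE -ai; have := src_tgt a; lia.
rewrite big_pred0 => [|a]; last by apply/negP => ai; apply: no_arrow; exists a.
case: (posnP i) => [i0 | i_gt0]; first by lia.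
have [a [aE _]] := @arrow_from r i i.-1 ltac:(lia).
by case: no_arrow; exists a; rewrite aE.
Qed.

(** The classes of the simple modules form a basis. *)
Lemma additive_alpha (phi : {ffun 'I_r -> int} -> int) x :
  {morph phi : y z / y + z} -> phi x = \sum_i x i * phi (alpha k i).
Proof.
move=> phiD.
have phi_add : zmod_morphism phi.
  move=> y z; apply: (addIr (phi z)); by rewrite -phiD !subrK.
pose f : {additive {ffun 'I_r -> int} -> int} :=
  HB.pack phi (GRing.isZmodMorphism.Build _ _ phi phi_add).
have xE : x = \sum_i alpha k i *~ x i.
  apply/ffunP => j; rewrite sum_ffunE (bigD1 j) //= big1 ?addr0 => [|i ij].
    by rewrite ffunMzE alphaE eqxx intz.
  by rewrite ffunMzE alphaE (negbTE ij) mul0rz.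
rewrite [in LHS]xE -[phi _]/(f _) raddf_sum; apply: eq_bigr => i _.
by rewrite raddfMz -mulrzr intz mulrC.
Qed.

(** By additivity it is enough to take y = alpha_j, the class of a module, and
    then the value is dim Hom(P_i, S_j). *)
Lemma euler_projE (E : {ffun 'I_r -> int} -> {ffun 'I_r -> int} -> int) i y :
  is_euler_form k E -> E (intv (dimv (proj_mod k i))) y = y i.
Proof.
case=> _ E_r E_mod; rewrite (additive_alpha _ (E_r _)).
rewrite (bigD1 i) //= big1 ?addr0 => [|j ji];
  rewrite (E_mod _ _ _ (ext1_proj _ _)) dim_hom_proj dimv_simple subr0.
  by rewrite eqxx mulr1.
by rewrite (negbTE ji) mulr0.
Qed.

(** Ringel form of the quiver. It follows from the case x = dim P_i, as
    alpha_i = dim P_i - dim P_(i-1). *)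
Lemma euler_formE (E : {ffun 'I_r -> int} -> {ffun 'I_r -> int} -> int) x y :
  is_euler_form k E ->
  E x y = \sum_i x i * y i - \sum_(a : arrow r) x (src a) * y (tgt a).
Proof.
move=> E_form; have [E_l _ _] := E_form.
rewrite (@additive_alpha (E^~ y)) => [|u v]; last exact: E_l.
rewrite (partition_big (@src r) xpredT) //= -sumrB; apply: eq_bigr => i _.
have E_sub u v : E (u - v) y = E u y - E v y.
  by apply: (addIr (E v y)); rewrite -E_l !subrK.
have E_sum (I : finType) (P : pred I) (F : I -> {ffun 'I_r -> int}) :
    E (\sum_(j | P j) F j) y = \sum_(j | P j) E (F j) y.
  by apply: (big_morph (E^~ y)) => [u v|]; rewrite ?E_l // -(subrr 0) E_sub subrr.
rewrite alpha_proj E_sub E_sum euler_projE // mulrBr mulr_sumr; congr (_ - _).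
by apply: eq_bigr => a /eqP <-; rewrite euler_projE.
Qed.

End EulerFormula.

(** * Submodules of serial modules *)

Definition interval (r i n : nat) : {ffun 'I_r -> nat} :=
  [ffun j : 'I_r => (i <= j < i + n)%N : nat].

Lemma decreasing_interval (r i : nat) (g : {ffun 'I_r -> nat}) :
  (forall j, g j <= 1)%N -> (forall j : 'I_r, (j < i)%N -> g j = 0%N) ->
  (forall j l : 'I_r, l = j.+1 :> nat -> (i <= j)%N -> (g l <= g j)%N) ->
  exists2 n, (n <= r - i)%N & g = interval r i n.
Proof.
move=> g_le1 g_lt g_decr.
(* The length is the first n such that g vanishes, or is not defined, at i + n. *)
pose P n := (n == r - i)%N ||
  [exists j : 'I_r, (j == (i + n)%N :> nat) && (g j == 0%N)].
have [|n /orP Pn n_min] := @ex_minnP P; first by exists (r - i)%N; rewrite /P eqxx.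
have n_le : (n <= r - i)%N by apply: n_min; rewrite /P eqxx.
exists n => //; apply/ffunP => j; rewrite ffunE.
have [/g_lt-> // | ij] := ltnP j i.
have [j_lt | j_ge] := ltnP j (i + n)%N.
  have : ~~ P (j - i)%N by apply/negP => /n_min; lia.
  rewrite negb_or => /andP[_ /existsPn/(_ j)]; rewrite subnKC // eqxx /=.
  by have := g_le1 j; case: (g j) => [|[]].
case: Pn => [/eqP nE | /existsP[l /andP[/eqP lE /eqP gl0]]].
  by have := ltn_ord j; lia.
apply/eqP; rewrite -leqn0 -gl0.
have H s (t : 'I_r) : t = (l + s)%N :> nat -> (g t <= g l)%N.
  elim: s t => [|s IHs] t tE.
    by rewrite (_ : t = l) //; apply: val_inj; rewrite /= tE addn0.
  have t_lt : (t.-1 < r)%N by have := ltn_ord t; lia.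
  by apply: leq_trans (g_decr (Ordinal t_lt) t _ _) (IHs _ _); rewrite /=; lia.
by apply: (H (j - l)%N); lia.
Qed.

Section Submodules.
Context (k : fieldType) (r : nat) (M : kQmod k r).
Implicit Types (U : {vspace M}) (a : arrow r) (i j : 'I_r).

Lemma sub_dimv_le U j : (sub_dimv U j <= dimv M j)%N.
Proof. by rewrite !ffunE dimvS // limgS // subvf. Qed.

Lemma submodule_sum U : submodule U -> U = (\sum_(j < r) idem M j @: U)%VS.
Proof.
case=> UI _; apply/eqP; rewrite eqEsubv; apply/andP; split; last exact/subv_sumP.
apply/subvP => v vU; rewrite -[v]id_lfunE -(idem_sum M) sum_lfunE.
by apply: memv_sumr => j _; apply: memv_img.
Qed.

(** The homogeneous components of a submodule are in direct sum, since the
    idempotents are orthogonal. *)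
Lemma dim_submodule U : submodule U -> \dim U = (\sum_j sub_dimv U j)%N.
Proof.
move=> /submodule_sum UE; rewrite [in LHS]UE.
have /directvP/= -> : directv (\sum_(j < r) idem M j @: U).
  apply/directv_sum_independent => us usU us0 j _.
  have [/memv_imgP[v _ vE]] := (usU j isT, tt); rewrite -(linear0 (idem M j)) -us0.
  rewrite linear_sum (bigD1 j) //= big1 ?addr0 => [|l lj].
    by rewrite vE idem_idem eqxx.
  by have /memv_imgP[w _ ->] := usU l isT; rewrite idem_idem eq_sym (negbTE lj).
by apply: eq_bigr => j _; rewrite ffunE.
Qed.

(** A submodule is the sum of its homogeneous components, and each of these is
    zero or everything. *)
Lemma submodule_eq U V : (forall j, dimv M j <= 1)%N ->
  submodule U -> submodule V -> sub_dimv U = sub_dimv V -> U = V.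
Proof.
move=> thin /submodule_sum UE /submodule_sum VE dimUV; rewrite UE VE.
apply: eq_bigr => j _.
have := congr1 (fun e : {ffun _} => e j) dimUV; rewrite !ffunE.
have := thin j; rewrite ffunE; set L := limg _ => L1.
have UL : (idem M j @: U <= L)%VS by rewrite limgS ?subvf.
have VL : (idem M j @: V <= L)%VS by rewrite limgS ?subvf.
have [/eqP | dimU_gt0] := posnP (\dim (idem M j @: U)).
  rewrite dimv_eq0 => /eqP-> /esym/eqP.
  by rewrite dimv0 dimv_eq0 => /eqP->.
move=> dim_eq; have full W : (W <= L)%VS -> (0 < \dim W)%N -> W = L.
  by move=> WL W0; apply/eqP; rewrite eqEdim WL (leq_trans L1).
by apply: etrans (full _ UL dimU_gt0) (esym (full _ VL _)); rewrite -dim_eq.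
Qed.

(** For a thin module supported on vertices from i on, this makes it uniserial with
    socle at i: paths carry nonzero homogeneous vectors to nonzero vectors at
    vertex i. *)
Definition arrows_inj (i : nat) : Prop :=
  forall a v, (i <= tgt a)%N -> idem M (src a) v = v -> act M a v = 0 -> v = 0.

(** The arrow into j maps the component at l injectively to the one at j. *)
Lemma sub_dimv_decr (i : nat) U j (l : 'I_r) : arrows_inj i -> submodule U ->
  l = j.+1 :> nat -> (i <= j)%N -> (sub_dimv U l <= sub_dimv U j)%N.
Proof.
move=> inj_i [UI UA] lj ij; rewrite !ffunE.
have [a [<- aj]] := arrow_from lj.
have tj : tgt a = j by apply: val_inj.
rewrite -tj.
rewrite -(@limg_dim_eq _ _ _ (act M a)); last first.
  apply/eqP; rewrite -subv0; apply/subvP => v; rewrite memv_cap memv0 memv_ker.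
  case/andP=> /memv_imgP[u _ ->] /eqP v0.
  apply/eqP/(inj_i a) => //; first by rewrite tj.
  by rewrite idem_idem eqxx.
apply/dimvS/subvP => _ /memv_imgP[_ /memv_imgP[u uU ->] ->].
rewrite act_idem eqxx; have := idem_act a (tgt a) u; rewrite eqxx => <-.
by rewrite memv_img // (subvP (UA a)) // memv_img.
Qed.

Lemma sub_dimv_interval (i : nat) U :
  arrows_inj i -> (forall j, sub_dimv U j <= 1)%N ->
  (forall j : 'I_r, (j < i)%N -> sub_dimv U j = 0%N) -> submodule U ->
  exists2 n, (n <= r - i)%N & sub_dimv U = interval r i n.
Proof.
move=> inj_i U_le1 U_lt subU; apply: decreasing_interval => //.
by move=> j l; apply: sub_dimv_decr inj_i subU.
Qed.

Lemma submodule_full : submodule (fullv : {vspace M}).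
Proof. by split=> ?; apply: subvf. Qed.

Definition truncation (m : nat) : {vspace M} :=
  (\sum_(j < r | (j < m)%N) limg (idem M j))%VS.

Lemma limg_idem_idem j l :
  (idem M j @: limg (idem M l))%VS = if j == l then limg (idem M j) else 0%VS.
Proof. by rewrite -limg_comp idemM; case: eqP; rewrite ?lim0g. Qed.

(** The arrows go down. *)
Lemma truncation_submodule m : submodule (truncation m).
Proof.
split=> [j|a]; rewrite limg_sum; apply/subv_sumP => l lm.
  rewrite limg_idem_idem; case: eqP => [->|_]; last exact: sub0v.
  exact: (sumv_sup l).
apply/subvP => _ /memv_imgP[_ /memv_imgP[u _ ->] ->].
rewrite act_idem; case: eqP => [lE|_]; last exact: mem0v.
have := idem_act a (tgt a) u; rewrite eqxx => <-.
have tm : (tgt a < m)%N by have := src_tgt a; rewrite -lE; lia.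
by apply: (subvP (sumv_sup (tgt a) tm (subvv _))); rewrite memv_img ?memvf.
Qed.

Lemma sub_dimv_truncation m j :
  sub_dimv (truncation m) j = if (j < m)%N then dimv M j else 0%N.
Proof.
rewrite !ffunE limg_sum; under eq_bigr do rewrite limg_idem_idem eq_sym.
case: ifP => jm.
  rewrite (bigD1 j) //= eqxx big1 ?addv0 // => l /andP[_ /negbTE->] //.
rewrite big1 ?dimv0 // => l lm; case: eqP => // lj.
by rewrite lj jm in lm.
Qed.

Lemma truncation_mono m m' : (m <= m')%N -> (truncation m <= truncation m')%VS.
Proof.
move=> mm'; apply/subv_sumP => j jm; apply: (sumv_sup j) => //.
exact: leq_trans jm mm'.
Qed.

End Submodules.

Section IntervalModules.
Context (k : fieldType) (r : nat).
Implicit Types (M : kQmod k r).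

(** The working description of S_i^(n): unlike the definition by socle and length,
    it gives the submodules directly. *)
Definition interval_mod M (i n : nat) : Prop :=
  [/\ (n <= r - i)%N, dimv M = interval r i n & arrows_inj M i].

Lemma interval_thin i n j : (interval r i n j <= 1)%N.
Proof. by rewrite ffunE leq_b1. Qed.

Lemma interval_inj i m n : (m <= r - i)%N -> (n <= r - i)%N ->
  interval r i m = interval r i n -> m = n.
Proof.
wlog mn : m n / (m <= n)%N.
  move=> H mr nr mn; have [le|/ltnW le] := leqP m n; first exact: H.
  by apply/esym/H.
move=> mr nr /ffunP E; apply/eqP; rewrite eqn_leq mn leqNgt; apply/negP => mn_lt.
have lt : (i + m < r)%N by lia.
by have := E (Ordinal lt); rewrite !ffunE /=; lia.
Qed.

Section Fixed.
Context (M : kQmod k r) (i n : nat).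
Hypothesis Mn : interval_mod M i n.

Lemma interval_mod_thin j : (dimv M j <= 1)%N.
Proof. by have [_ -> _] := Mn; apply: interval_thin. Qed.

Lemma sub_dimv_truncation_interval m : (m <= n)%N ->
  sub_dimv (truncation M (i + m)%N) = interval r i m.
Proof.
move=> mn; have [_ dimM _] := Mn; apply/ffunP => j.
by rewrite sub_dimv_truncation dimM !ffunE; case: ifP; lia.
Qed.

(** The dimension vector of a submodule decreases from i on, so it is that of a
    truncation; thin modules have at most one submodule of each dimension
    vector. *)
Lemma submodule_truncation U : submodule U ->
  exists2 m, (m <= n)%N & U = truncation M (i + m)%N.
Proof.
move=> subU; have [n_le dimM inj_i] := Mn.
have U_le j := sub_dimv_le U j.
have [j|j j_lt|m m_le dimU] := @sub_dimv_interval _ _ M i U inj_i _ _ subU.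
- exact: leq_trans (U_le j) (interval_mod_thin j).
- by apply/eqP; rewrite -leqn0; apply: leq_trans (U_le j) _; rewrite dimM ffunE; lia.
have mn : (m <= n)%N.
  rewrite leqNgt; apply/negP => nm; have lt : (i + n < r)%N by lia.
  by have := U_le (Ordinal lt); rewrite dimU dimM !ffunE /=; lia.
exists m => //; apply: (submodule_eq interval_mod_thin) => //.
  exact: truncation_submodule.
by rewrite sub_dimv_truncation_interval.
Qed.

(** The terms of a composition series are truncations by submodule_truncation, and
    between two that are not consecutive there is a third one, so that the m-th
    term is the truncation of length m. *)
Lemma interval_mod_length l : has_length M l -> l = n.
Proof.
have [n_le dimM _] := Mn.
case=> c [c0 cl c_sub c_max].
suff H m : (m <= l)%N -> (m <= n)%N /\ c m = truncation M (i + m)%N.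
  have [l_le cE] := H l (leqnn l).
  apply: (@interval_inj i); [by apply: leq_trans l_le _ | by [] |].
  by rewrite -sub_dimv_truncation_interval // -cE cl -dimM.
elim: m => [_|m IHm m_lt].
  split=> //; rewrite c0; apply/esym/eqP; rewrite -dimv_eq0.
  rewrite dim_submodule; last exact: truncation_submodule.
  rewrite sub_dimv_truncation_interval // big1 // => j _; rewrite ffunE; lia.
have [mn cm] := IHm (ltnW m_lt).
have [c_le c_neq c_simple] := c_max m m_lt.
have [q qn cq] := submodule_truncation (c_sub m.+1 m_lt).
have mq : (m < q)%N.
  rewrite ltnNge; apply/negP => qm; apply: c_neq; apply/eqP.
  by rewrite eqEsubv c_le cq cm truncation_mono // leq_add2l.
have m1n : (m < n)%N by apply: leq_trans mq qn.
have T_sub := truncation_submodule M (i + m.+1)%N.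
have [||E|->] := c_simple _ T_sub; last by [].
- by rewrite cm truncation_mono // leq_add2l.
- by rewrite cq truncation_mono // leq_add2l.
have /interval_inj : interval r i m.+1 = interval r i m.
  by rewrite -!sub_dimv_truncation_interval ?E ?cm // ltnW.
by move=> /(_ _ _)/eqP; lia.
Qed.

End Fixed.

Lemma simple_interval_mod (i : 'I_r) : interval_mod (simple_mod k i) i 1.
Proof.
split=> [||a v ia]; first by have := ltn_ord i; lia.
  by apply/ffunP => j; rewrite dimv_simple ffunE -(inj_eq val_inj) /=; lia.
rewrite /= /simple_idem; case: eqP => [iE|_]; last by rewrite zero_lfunE.
by have := src_tgt a; rewrite -iE; lia.
Qed.

End IntervalModules.

Section Serial.
Context (k : fieldType) (r : nat) (M : kQmod k r) (i : 'I_r).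
Hypothesis socM : has_socle M (simple_mod k i).

(** A homogeneous vector killed by all arrows spans a simple submodule, hence lies
    in the socle, which is a line at vertex i. *)
Lemma socle_vector : exists w : M,
  [/\ w != 0, forall j, idem M j w = if j == i then w else 0 &
  forall j v, idem M j v = v -> (forall a, act M a v = 0) -> v \in <[w]>%VS].
Proof.
have [f [f_hom f_inj [_ soc _]]] := socM.
pose w := f (1 : k^o).
have limf : limg f = <[w]>%VS.
  apply/eqP; rewrite eqEsubv -memvE memv_img ?memvf // andbT.
  apply/subvP => _ /memv_imgP[x _ ->].
  have -> : x = (x : k) *: (1 : k^o) by rewrite [RHS]mulr1.
  by rewrite linearZ memvZ // memv_line.
exists w; split=> [|j|j v vj va].
- apply: contraTneq (oner_neq0 k) => w0.
  have /lker0P inj : lker f == 0%VS by rewrite f_inj.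
  by rewrite negbK; apply/eqP/inj; rewrite linear0.
- rewrite -(hom_idem _ _ f_hom) /= /simple_idem eq_sym.
  by case: eqP => _; rewrite ?id_lfunE // zero_lfunE linear0.
have [->|v_neq0] := eqVneq v 0; first exact: mem0v.
rewrite -limf memvE; apply: soc; split.
- split=> [l|a]; rewrite limg_line -memvE.
    rewrite -[in idem M l v]vj idem_idem.
    by case: eqP => [->|_]; rewrite ?mem0v // vj memv_line.
  by rewrite va mem0v.
- by apply/eqP; rewrite -dimv_eq0 dim_vline v_neq0.
move=> W _ Wv; have [/eqP|W_gt0] := posnP (\dim W).
  by rewrite dimv_eq0 => /eqP; left.
by right; apply/eqP; rewrite eqEdim Wv dim_vline v_neq0.
Qed.

(** Off vertex i, no nonzero homogeneous vector is killed by all arrows. So each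
    arrow is injective unless it starts at i; descending along arrows gives
    M_j = 0 for j < i, then M_i is the socle, and the dimensions decrease from
    there on. *)
Lemma socle_interval_mod : exists n, interval_mod M i n.
Proof.
have [w [w_neq0 wI w_soc]] := socle_vector.
have killed j v : j != i -> idem M j v = v -> (forall a, act M a v = 0) -> v = 0.
  move=> ji vj va; have /vlineP[c vE] := w_soc j v vj va.
  by rewrite -vj vE linearZ /= wI (negbTE ji) scaler0.
have inj : arrows_inj M i.
  move=> a v ia va av; apply: (killed (src a)) => // [|b].
    by rewrite -(inj_eq val_inj) /=; have := src_tgt a; lia.
  rewrite -va act_idem; case: eqP => // /src_inj ab.
  by rewrite -ab av.
have below (j : 'I_r) : (j < i)%N -> forall v, idem M j v = v -> v = 0.
  elim/ltn_ind: {j}(j : nat) {-2}j (erefl (j : nat)) => m IH j jm ji v vj.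
  apply: (killed j) => // [|a]; first by rewrite -(inj_eq val_inj) /=; lia.
  have := act_idem a j v; rewrite vj; case: eqP => // ja _; have aE := src_tgt a.
  apply: (IH (tgt a) _ _ erefl); rewrite ?idem_act ?eqxx //.
    by rewrite -jm ja aE.
  by apply: ltn_trans ji; rewrite ja aE.
have dim_lt (j : 'I_r) : (j < i)%N -> dimv M j = 0%N.
  move=> ji; apply/eqP; rewrite ffunE dimv_eq0 -subv0.
  apply/subvP => _ /memv_imgP[v _ ->].
  by rewrite (below j ji (idem M j v)) ?mem0v // idem_idem eqxx.
have limgi : limg (idem M i) = <[w]>%VS.
  apply/eqP; rewrite eqEsubv -memvE; apply/andP; split.
    apply/subvP => _ /memv_imgP[v _ ->]; apply: (w_soc i) => [|a].
      by rewrite idem_idem eqxx.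
    rewrite act_idem; case: eqP => // ia; have := src_tgt a; rewrite -ia => iE.
    apply: (below (tgt a)); first by rewrite iE.
    by rewrite idem_act eqxx.
  by apply/memv_imgP; exists w; rewrite ?memvf // wI eqxx.
have dimi : dimv M i = 1%N by rewrite ffunE limgi dim_vline w_neq0.
have full := submodule_full M.
have dim_le1 (j : 'I_r) : (dimv M j <= 1)%N.
  have [/dim_lt-> // | ij] := ltnP j i.
  elim: {j}(j - i)%N {-2}j (erefl (j - i)%N) ij => [|s IHs] j js ij.
    by rewrite (_ : j = i) ?dimi //; apply: val_inj; rewrite /=; lia.
  have lt : (j.-1 < r)%N by have := ltn_ord j; lia.
  have step := @sub_dimv_decr _ _ M i fullv (Ordinal lt) j inj full.
  by apply: leq_trans (step _ _) (IHs (Ordinal lt) _ _); rewrite /=; lia.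
have [n n_le dimM] := sub_dimv_interval inj dim_le1 dim_lt full.
by exists n; split.
Qed.

End Serial.

Lemma serial_interval_mod (k : fieldType) (r : nat) (i : 'I_r) n (M : kQmod k r) :
  is_serial i n M -> interval_mod M i n.
Proof.
by case=> _ /socle_interval_mod[m Mm] /(interval_mod_length Mm)->.
Qed.

(** * Laurent polynomials and Chebyshev polynomials *)

(** The recursion z_(n+1) = x_n z_n - z_(n-1) with
    x_n = (U_(i+n+2) + U_(i+n)) / U_(i+n+1) has the solution z_n = U_(i+n+1).
    The factor U_i times the sum is what reduction of order gives for the
    solution with z_0 = 1 and z_1 = x_0, the discrete Wronskian being constant. *)
Definition frieze (F : fieldType) (U : nat -> F) (i n : nat) : F :=
  U i * U (i + n)%N.+1 * \sum_(m < n.+1) (U (i + m)%N * U (i + m)%N.+1)^-1.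

Lemma frieze1 (F : fieldType) (U : nat -> F) i : (forall j, U j != 0) ->
  frieze U i 1 = (U i.+2 + U i) / U i.+1.
Proof.
move=> U0; rewrite /frieze big_ord_recr big_ord1 /= addn0 !addn1.
have := U0 i; have := U0 i.+1; have := U0 i.+2.
by move=> u2 u1 u0; field; rewrite u0 u1 u2.
Qed.

(** Let s_n be the sum in frieze U i n. As s_n - s_(n-1) is the inverse of
    U_(i+n) U_(i+n+1), the recursion of the Chebyshev polynomials becomes an
    identity of rational functions in a few values of U and one of these sums. *)
Lemma chebyshev_frieze (F : fieldType) (U : nat -> F) (x : nat -> F) i n :
  (forall j, U j != 0) -> (forall j, (j < n)%N -> x j = frieze U (i + j)%N 1) ->
  chebyshev n x = frieze U i n.
Proof.
move=> U0; elim/ltn_ind: n => -[|[|n]] IHn xE.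
- by rewrite /frieze big_ord1 /= !addn0 mulfV // mulf_neq0.
- by rewrite /= xE // addn0.
have -> : chebyshev n.+2 x = x n.+1 * chebyshev n.+1 x - chebyshev n x by [].
rewrite !IHn // => [|j jn|j jn]; last 2 first.
- by apply: xE; lia.
- by apply: xE; lia.
rewrite xE // frieze1 // /frieze.
have sumS q : \sum_(m < q.+1) (U (i + m)%N * U (i + m)%N.+1)^-1 =
    \sum_(m < q) (U (i + m)%N * U (i + m)%N.+1)^-1 +
    (U (i + q)%N * U (i + q)%N.+1)^-1.
  by rewrite big_ord_recr.
rewrite (sumS n.+2) (sumS n.+1) !addnS.
have := U0 (i + n).+1%N; have := U0 (i + n).+2%N; have := U0 (i + n).+3%N.
by move=> u3 u2 u1; field; rewrite u1 u2 u3.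
Qed.

(** * Quiver Grassmannians of serial modules *)

Section Frames.
Context (k : fieldType) (r : nat) (M : kQmod k r).

(** A basis of U is a frame of U. *)
Lemma frame_exists (U : {vspace M}) n : \dim U = n ->
  exists2 y : 'rV[k]_(n * \dim {:M}), row_free (vec_mx y) & frame_span y = U.
Proof.
move=> <-; pose A : 'M[k]_(\dim U, \dim {:M}) :=
  \matrix_(i, j) coord (vbasis {:M}) j (vbasis U)`_i.
have AE (i : 'I_(\dim U)) : \sum_j A i j *: (vbasis {:M})`_j = (vbasis U)`_i.
  rewrite [RHS](coord_vbasis (memvf _)).
  by apply: eq_bigr => j _; rewrite mxE.
exists (mxvec A).
  rewrite mxvecK; apply: inj_row_free => v vA0; apply/rowP => i; rewrite mxE.
  have /freeP/(_ (v 0)) : free (vbasis U) by apply: basis_free (vbasisP U).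
  apply; under eq_bigr do rewrite -AE scaler_sumr.
  rewrite exchange_big big1 // => j _.
  under eq_bigr do rewrite scalerA; rewrite -scaler_suml.
  by have /rowP/(_ j) := vA0; rewrite !mxE => ->; rewrite scale0r.
rewrite /frame_span mxvecK -[RHS](span_basis (vbasisP U)); congr (<<_>>)%VS.
under eq_map do rewrite AE.
by rewrite (map_comp (nth 0 (vbasis U)) val) val_enum_ord -/(mkseq _ _)
  -[X in mkseq _ X](size_tuple (vbasis U)) mkseq_nth.
Qed.

End Frames.

Section Grassmannians.
Context (k : closedFieldType) (r : nat) (chi : variety k -> int).
Hypothesis chiP : euler_char chi.
Context (M : kQmod k r) (i n : nat).
Hypothesis Mn : interval_mod M i n.

Lemma chi_gr_interval m : (m <= n)%N -> chi (quiver_gr M (interval r i m)) = 1.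
Proof.
move=> mn; have dimT := sub_dimv_truncation_interval Mn mn.
apply: (@euler_char_pt _ _ (quiver_gr M (interval r i m))
          (truncation M (i + m)%N)) => // [|y [_ y_sub y_dim]].
  have [y y_free yE] : exists2 y : 'rV[k]_((\sum_j interval r i m j)%N * \dim {:M}),
      row_free (vec_mx y) & frame_span y = truncation M (i + m)%N.
    apply: frame_exists; rewrite dim_submodule; last exact: truncation_submodule.
    by rewrite dimT.
  by exists y; split; rewrite ?yE //; exact: truncation_submodule.
apply: (submodule_eq (interval_mod_thin Mn)) => //.
  exact: truncation_submodule.
by rewrite dimT.
Qed.

Lemma chi_gr_empty e : (forall m, (m <= n)%N -> e <> interval r i m) ->
  chi (quiver_gr M e) = 0.
Proof.
move=> e_neq; apply: euler_char_empty => // y [_ y_sub y_dim].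
have [m mn yE] := submodule_truncation Mn y_sub.
by apply: (e_neq m mn); rewrite -y_dim yE (sub_dimv_truncation_interval Mn).
Qed.

End Grassmannians.

(** * Cluster characters of serial modules *)

(** The variable u_(j-1), extended by 1 to all j outside [1, r]; the two outer
    values take care of the ends of the quiver. *)
Definition frieze_var (r j : nat) : Zu r := \prod_(l < r | l.+1 == j) u_ l.

Lemma u_neq0 r (l : 'I_r) : u_ l != 0.
Proof.
rewrite /u_ tofrac_eq0; apply/eqP => X0.
have := congr1 (mpoly.mcoeff (mpoly.mnm1 l)) X0.
by rewrite mpoly.mcoeffX eqxx mpoly.mcoeff0.
Qed.

Lemma frieze_var_neq0 r j : frieze_var r j != 0.
Proof. by apply/prodf_neq0 => l _; exact: u_neq0. Qed.

Lemma prod_frieze_var r j :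
  \prod_(l < r) u_ l ^ (l.+1 == j)%:Z = frieze_var r j.
Proof.
rewrite [RHS]big_mkcond; apply: eq_bigr => l _.
by case: eqP => _; rewrite ?expr1z ?expr0z.
Qed.

Section CC.
Context (k : fieldType) (r : nat).
Context (E : {ffun 'I_r -> int} -> {ffun 'I_r -> int} -> int).
Hypothesis E_form : is_euler_form k E.

(** Stated with a function G on nat that extends x by zero on the right, so that
    the last vertex, into which no arrow goes, is not special. *)
Lemma euler_alpha_r (G : nat -> int) (x : {ffun 'I_r -> int}) (j : 'I_r) :
  (forall l, x l = G l) -> G r = 0 -> E x (alpha k j) = G j - G j.+1.
Proof.
move=> xG Gr; rewrite (euler_formE _ _ E_form); congr (_ - _).
  rewrite (bigD1 j) //= big1 ?addr0 => [|l lj]; rewrite alphaE.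
    by rewrite eqxx mulr1.
  by rewrite eq_sym (negbTE lj) mulr0.
have [lt | ge] := ltnP j.+1 r.
  have [a [aE tE]] := @arrow_from r (Ordinal lt) j erefl.
  rewrite (bigD1 a) //= big1 ?addr0 => [|b ba].
    by rewrite xG aE alphaE -(inj_eq val_inj) /= tE eqxx mulr1.
  rewrite alphaE; case: eqP => [jb|]; last by rewrite mulr0.
  case/eqP: ba; apply: src_inj; apply: val_inj.
  by rewrite /= (src_tgt a) (src_tgt b) -jb tE.
rewrite big1 => [|a _]; first by rewrite -Gr; congr G; have := ltn_ord j; lia.
rewrite alphaE; case: eqP => [ja|]; last by rewrite mulr0.
by have := ltn_ord (src a); rewrite (src_tgt a) -ja; lia.
Qed.

(** As above; the shift of the index leaves room for the value 0 to the left of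
    vertex 0. *)
Lemma euler_alpha_l (G : nat -> int) (y : {ffun 'I_r -> int}) (j : 'I_r) :
  (forall l, y l = G l.+1) -> G 0%N = 0 -> E (alpha k j) y = G j.+1 - G j.
Proof.
move=> yG G0; rewrite (euler_formE _ _ E_form); congr (_ - _).
  rewrite (bigD1 j) //= big1 ?addr0 => [|l lj]; rewrite alphaE.
    by rewrite eqxx mul1r.
  by rewrite eq_sym (negbTE lj) mul0r.
have [j0 | gt] := posnP j.
  rewrite j0 G0 big1 // => a _.
  rewrite alphaE; case: eqP => [ja|]; last by rewrite mul0r.
  by have := src_tgt a; rewrite -ja j0.
have [a [aE tE]] := @arrow_from r j j.-1 ltac:(lia).
rewrite (bigD1 a) //= big1 ?addr0 => [|b ba].
  by rewrite alphaE aE eqxx mul1r yG tE prednK.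
rewrite alphaE; case: eqP => [jb|]; last by rewrite mul0r.
by case/eqP: ba; apply: src_inj; rewrite aE -jb.
Qed.

(** Differences of indicator functions of intervals are supported at their ends. *)
Lemma interval_exponent i n m (j : 'I_r) : (m <= n)%N -> (i + n <= r)%N ->
  - E (intv (interval r i m)) (alpha k j) -
    E (alpha k j) (intv (interval r i n) - intv (interval r i m)) =
  (j.+1 == i)%:Z + (j.+1 == (i + n).+1)%:Z
  - (j.+1 == i + m)%N%:Z - (j.+1 == (i + m).+1)%:Z.
Proof.
move=> mn nr.
rewrite (@euler_alpha_r (fun l => (i <= l < i + m)%N%:Z)) => [|l|]; last 2 first.
- by rewrite intvE ffunE.
- by lia.
rewrite (@euler_alpha_l (fun l => (i + m < l <= i + n)%N%:Z)) => [|l|]; last 2 first.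
- rewrite !ffunE; lia.
- by lia.
lia.
Qed.

End CC.

(** The submodule of length m contributes the monomial
    U_i U_(i+n+1) / (U_(i+m) U_(i+m+1)). *)
Lemma CC_interval (k : closedFieldType) (r : nat) (chi : variety k -> int)
    (E : {ffun 'I_r -> int} -> {ffun 'I_r -> int} -> int)
    (M : kQmod k r) (i : 'I_r) (n : nat) :
  euler_char chi -> is_euler_form k E -> interval_mod M i n ->
  CC chi E M = frieze (frieze_var r) i n.
Proof.
move=> chiP E_form Mn; have [n_le dimM _] := Mn.
pose s := [seq interval r i m | m <- index_iota 0 n.+1].
have s_uniq : uniq s.
  rewrite map_inj_in_uniq ?iota_uniq // => m m'; rewrite !mem_index_iota => mn m'n.
  by apply: interval_inj; lia.
rewrite /CC -(fsbig_widen [set` s]) //=; last first.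
  move=> e [_ /= es]; rewrite (chi_gr_empty chiP Mn) ?mul0r // => m mn eE.
  by apply: es; apply/mapP; exists m => //; rewrite mem_index_iota.
rewrite -fsbig_seq // /s big_map big_mkord /frieze mulr_sumr.
apply: eq_bigr => m _; have mn : (m <= n)%N by rewrite -ltnS.
rewrite (chi_gr_interval chiP Mn mn) mul1r dimM.
have nr : (i + n <= r)%N by have := ltn_ord i; lia.
transitivity (\prod_(j < r) (u_ j ^ (j.+1 == i)%:Z * u_ j ^ (j.+1 == (i + n).+1)%:Z
  / (u_ j ^ (j.+1 == i + m)%N%:Z * u_ j ^ (j.+1 == (i + m).+1)%:Z))).
  apply: eq_bigr => j _; rewrite (interval_exponent E_form) //.
  by rewrite !expfzDr ?u_neq0 // -!invr_expz invfM !mulrA.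
by rewrite big_split prodfV !big_split !prod_frieze_var.
Qed.

Theorem proposition4p1 (r : nat) (hr : (1 <= r)%N) (k : closedFieldType)
    (chi : variety k -> int) (hchi : euler_char chi)
    (E : {ffun 'I_r -> int} -> {ffun 'I_r -> int} -> int)
    (hE : is_euler_form k E)
    (i : 'I_r) (n : nat) (hn : (1 <= n <= r - i)%N)
    (M : kQmod k r) (hM : is_serial i n M) :
  CC chi E M =
  chebyshev n (fun j : nat => CC chi E (simple_mod k (insubd i (i + j)%N))).
Proof.
rewrite (CC_interval hchi hE (serial_interval_mod hM)).
apply/esym/chebyshev_frieze => [j|j jn]; first exact: frieze_var_neq0.
rewrite (CC_interval hchi hE (simple_interval_mod k _)).
by rewrite val_insubd ifT //; lia.
Qed.
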